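(* Let $f,g$ satisfy the standing assumptions below and let $\beta\ge\max\{\frac{8M_fQ_g}{\mu^3},\frac{4M_fQ_gL_g}{\mu^{3.5}}\}$. Consider Algorithm 3: from $(x_0,y_0)$, for $k=0,1,\dots$: compute $w_k$ with $\|\nabla^2_{yy}g(x_k,y_k)w_k-\nabla_yg(x_k,y_k)\|\le\varepsilon_{1,k}$; choose $(d_{x,k},d_{y,k})\in\mathcal{D}_f(x_k,y_k-w_k)$; set $p_{x,k}=d_{x,k}-\nabla^2_{xy}g(x_k,y_k)\nabla^2_{yy}g(x_k,y_k)^{-1}d_{y,k}$; set $x_{k+1}=x_k-\eta_kp_{x,k}$ and $y_{k+1}=y_k-\eta_k\big(\beta\nabla_yg(x_k,y_k)-\nabla^2_{yx}g(x_k,y_k)\nabla^2_{yy}g(x_k,y_k)^{-1}p_{x,k}\big)$. Suppose: (a) $\sup_k\|x_k\|+\|y_k\|<\infty$; (b) $\eta_k\ge0$, $\sum_k\eta_k=\infty$, $\sum_k\eta_k^2<\infty$; (c) the set $\{f(x,y):(x,y)\text{ is a }\mathcal{D}_f\text{-stationary point of (BLO)}\}$ has empty interior; and $\lim_k\varepsilon_{1,k}=0$. Then every limit point of $\{(x_k,y_k)\}$ is a $\mathcal{D}_f$-stationary point of (BLO), and $\{h(x_k,y_k)\}$ converges.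
   Context: Standing assumptions. (A1) Constants $M_f,\mu,L_g,Q_g>0$ exist such that: $f:\mathbb{R}^n\times\mathbb{R}^p\to\mathbb{R}$ is $M_f$-Lipschitz; $g$ is twice differentiable with $\nabla^2_{yy}g\succeq\mu I_p$; $\nabla g$ is $L_g$-Lipschitz; $\nabla^2_{yy}g,\nabla^2_{xy}g$ are $Q_g$-Lipschitz; $\nabla^2_{yy}g$ is continuously differentiable ($\nabla^2_{xy}g\in\mathbb{R}^{n\times p}$ has entries $\partial^2g/\partial x_i\partial y_j$, $\nabla^2_{yx}g$ is its transpose). (A2) $f$ is a potential function of a conservative field $\mathcal{D}_f$ with compact convex values of norm at most $M_f$ (conservative field: closed graph, nonempty compact values, $\int_0^1\max_{v\in\mathcal{D}(\gamma(t))}\langle\gamma'(t),v\rangle dt=0$ along every absolutely continuous loop; potential: $f(\gamma(1))-f(\gamma(0))$ equals this integral along any absolutely continuous curve). Notation: $\mathcal{A}(x,y):=y-\nabla^2_{yy}g(x,y)^{-1}\nabla_yg(x,y)$, $h(x,y):=f(x,\mathcal{A}(x,y))+\frac\beta2\|\nabla_yg(x,y)\|^2$. $(x,y)$ is a $\mathcal{D}_f$-stationary point of (BLO) (the problem $\min f(x,y)$ s.t. $y=\arg\min_{y'}g(x,y')$) if there is $(d_x,d_y)\in\mathcal{D}_f(x,y)$ with $d_x-\nabla^2_{xy}g(x,y)\nabla^2_{yy}g(x,y)^{-1}d_y=0$ and $\nabla_yg(x,y)=0$.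
   Formalization: In the update of y_{k+1}, the product ∇²_{yx}g ∇²_{yy}g^{-1} p_{x,k} is undefined for n ≠ p (shapes p×n, p×p, n×1); it is read as ∇²_{yy}g^{-1} ∇²_{yx}g p_{x,k}. *)

(* Defs.v *)
(* R : realType, vectors are column
   vectors 'cV[R]_m, the pair (x,y) in R^n x R^p is the column vector
   col_mx x y : 'cV[R]_(n+p). *)
From mathcomp Require Import all_boot all_order all_algebra.
From mathcomp Require Import all_classical all_reals all_analysis.
Set Implicit Arguments.
Unset Strict Implicit.
Unset Printing Implicit Defensive.
Import Order.TTheory GRing.Theory Num.Theory.
Import numFieldNormedType.Exports.
Local Open Scope ring_scope.
Local Open Scope classical_set_scope.

Section Defs.
Variable R : realType.

Definition enorm {m : nat} (v : 'cV[R]_m) : R :=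
  Num.sqrt (\sum_(i < m) v i ord0 ^+ 2).

Definition opnorm {m k : nat} (A : 'M[R]_(m, k)) : R :=
  sup [set enorm (A *m v) | v in [set v : 'cV[R]_k | enorm v <= 1]].

Definition inner {m : nat} (u v : 'cV[R]_m) : R := (u^T *m v) ord0 ord0.

Definition convex_subset {m : nat} (S : set 'cV[R]_m) : Prop :=
  forall a b (t : R), S a -> S b -> 0 <= t -> t <= 1 ->
    S (t *: a + (1 - t) *: b).

Definition abs_cont01 {m : nat} (gam : R -> 'cV[R]_m) : Prop :=
  forall e : R, 0 < e -> exists2 del : R, 0 < del &
    forall (k : nat) (a b : 'I_k -> R),
      (forall i, 0 <= a i /\ a i <= b i /\ b i <= 1) ->
      (forall i j, i != j -> b i <= a j \/ b j <= a i) ->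
      \sum_(i < k) (b i - a i) < del ->
      \sum_(i < k) enorm (gam (b i) - gam (a i)) < e.

(* t |-> max_{v in D(gam t)} <gam'(t), v>  (D has compact values) *)
Definition field_integrand {m : nat} (D : 'cV[R]_m -> set 'cV[R]_m)
  (gam : R -> 'cV[R]_m) (t : R) : R :=
  sup [set inner ('D_1 gam t) v | v in D (gam t)].

Definition path_integral {m : nat} (D : 'cV[R]_m -> set 'cV[R]_m)
  (gam : R -> 'cV[R]_m) : \bar R :=
  (\int[@lebesgue_measure R]_(t in `[0%R, 1%R]) (field_integrand D gam t)%:E)%E.

(* conservative field (Bolte--Pauwels) *)
Definition conservative_field {m : nat} (D : 'cV[R]_m -> set 'cV[R]_m) : Prop :=
  closed [set q : 'cV[R]_m * 'cV[R]_m | D q.1 q.2] /\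
  (forall z, D z !=set0) /\ (forall z, compact (D z)) /\
  (forall gam, abs_cont01 gam -> gam 0 = gam 1 -> path_integral D gam = 0%E).

Definition is_potential {m : nat} (F : 'cV[R]_m -> R)
  (D : 'cV[R]_m -> set 'cV[R]_m) : Prop :=
  forall gam, abs_cont01 gam ->
    path_integral D gam = ((F (gam 1) - F (gam 0))%:E)%E.

Variables n p : nat.

Definition joint (F : 'cV[R]_n -> 'cV[R]_p -> R) (z : 'cV[R]_(n + p)) : R :=
  F (usubmx z) (dsubmx z).

Definition e_vec {m : nat} (i : 'I_m) : 'cV[R]_m := delta_mx i ord0.

Definition gradx (g : 'cV[R]_n -> 'cV[R]_p -> R) x y : 'cV[R]_n :=
  \col_i derive (fun x' => g x' y) x (e_vec i).
Definition grady (g : 'cV[R]_n -> 'cV[R]_p -> R) x y : 'cV[R]_p :=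
  \col_j derive (g x) y (e_vec j).
Definition Hyy (g : 'cV[R]_n -> 'cV[R]_p -> R) x y : 'M[R]_p :=
  \matrix_(i, j) derive (fun y' => grady g x y' i ord0) y (e_vec j).
Definition Hxy (g : 'cV[R]_n -> 'cV[R]_p -> R) x y : 'M[R]_(n, p) :=
  \matrix_(i, j) derive (fun x' => grady g x' y j ord0) x (e_vec i).
Definition Hyx (g : 'cV[R]_n -> 'cV[R]_p -> R) x y : 'M[R]_(p, n) :=
  (Hxy g x y)^T.

Definition gradg (g : 'cV[R]_n -> 'cV[R]_p -> R) (z : 'cV[R]_(n + p)) :
  'cV[R]_(n + p) :=
  col_mx (gradx g (usubmx z) (dsubmx z)) (grady g (usubmx z) (dsubmx z)).

Definition Hyy_joint (g : 'cV[R]_n -> 'cV[R]_p -> R) (z : 'cV[R]_(n + p)) :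
  'M[R]_p := Hyy g (usubmx z) (dsubmx z).

Definition Amap (g : 'cV[R]_n -> 'cV[R]_p -> R) x y : 'cV[R]_p :=
  y - invmx (Hyy g x y) *m grady g x y.

Definition hfun (f g : 'cV[R]_n -> 'cV[R]_p -> R) (beta : R) x y : R :=
  f x (Amap g x y) + beta / 2 * enorm (grady g x y) ^+ 2.

Definition stationary (Df : 'cV[R]_(n + p) -> set 'cV[R]_(n + p))
  (g : 'cV[R]_n -> 'cV[R]_p -> R) x y : Prop :=
  exists d, Df (col_mx x y) d /\
    usubmx d - Hxy g x y *m invmx (Hyy g x y) *m dsubmx d = 0 /\
    grady g x y = 0.

Definition px_dir (g : 'cV[R]_n -> 'cV[R]_p -> R) x y
  (d : 'cV[R]_(n + p)) : 'cV[R]_n :=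
  usubmx d - Hxy g x y *m invmx (Hyy g x y) *m dsubmx d.

Definition seq_limit_point (xs : nat -> 'cV[R]_n) (ys : nat -> 'cV[R]_p)
  (xb : 'cV[R]_n) (yb : 'cV[R]_p) : Prop :=
  exists phi : nat -> nat, (forall k, (phi k < phi k.+1)%N) /\
    (xs \o phi) @ \oo --> xb /\ (ys \o phi) @ \oo --> yb.

End Defs.

(* Main.v *)
(* The equation [du = - beta H u] satisfied by [u = grady g] along the iteration
   forces [u] to tend to 0, so [h] and [f] have the same limits and every limit
   point is feasible.  Rescaled pieces of the trajectory converge along an
   ultrafilter to Lipschitz curves; by upper semicontinuity and convexity of
   [Df], the velocity of such a curve is [(- p, H^-1 Hyx p)] wherever it exists,
   for some [d] in [Df] with reduced gradient [p], and pairs with [d] to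
   [- |p|^2] because [H] is symmetric.  Lipschitz curves are differentiable
   almost everywhere, so integrating the potential shows that [f] drops by a
   definite amount near every limit point that is not stationary.  Empty interior
   of the critical values then forbids [f] from oscillating, hence [f] converges,
   and a nonstationary limit point would contradict this convergence. *)
From HB Require Import structures.
Require Import Defs.
From mathcomp Require Import all_boot all_order all_algebra.
From mathcomp Require Import all_classical all_reals all_analysis.
From mathcomp Require Import ring lra.
Set Implicit Arguments.
Unset Strict Implicit.
Unset Printing Implicit Defensive.
Import Order.TTheory GRing.Theory Num.Theory.
Import numFieldNormedType.Exports.
Local Open Scope ring_scope.
Local Open Scope classical_set_scope.

(** The integrand of the potential is a maximum over [Df], and a single element of [Df] bounds a
    maximum only from below. In backward time the element that produces the velocity of a limit
    curve also gives the bound needed; in forward time it would give nothing. The inverse-Hessian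
    term of the y-step is the first-order response of [grady g] to the x-step: it cancels that
    response, so [grady g] contracts up to an error of order [eta k ^+ 2] whatever [d k] was chosen.
    An ultrafilter provides limits at all times of a curve at once, so no diagonal extraction and no
    equicontinuity theorem is needed. Weak limits of velocities are avoided as well: where the limit
    curve is differentiable, its difference quotient is compared with an average of directions up to
    a tolerance [e], and a bound on the integrand survives [e] tending to 0. *)

(** * Differentiability almost everywhere of Lipschitz functions, and lower bounds of integrals *)

Section Lebesgue_derivability.
Variable R : realType.
Local Notation mu := (@lebesgue_measure R).

(** Both outer measures are infima over the same countable covers by half-open intervals, so
    comparing interval lengths suffices, for every set [E]. *)
Lemma stieltjes_lipschitz (G : cumulative R R) (K : R) : 0 < K ->
  (forall s t, s <= t -> G t - G s <= K * (t - s)) ->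
  forall E, (lebesgue_stieltjes_measure G E <= K%:E * mu E)%E.
Proof.
move=> K0 GK E.
rewrite -lee_pdivrMl//.
rewrite /mu /lebesgue_measure /lebesgue_stieltjes_measure /measure_extension.
apply: le_ereal_inf_tmp => _ [A [mA EA] <-].
rewrite lee_pdivrMl// -nneseriesZl; last by move=> i _; exact: wlength_ge0.
apply: (@le_trans _ _ (\sum_(0 <= k <oo) wlength G (A k))%E).
  by apply: ereal_inf_lbound; exists A.
apply: lee_nneseries => [i _ _|k _]; first exact: wlength_ge0.
have /ocitvP[->|[[a b] /= ab ->]] := mA k.
  rewrite wlength0; apply: mule_ge0; first by rewrite lee_fin ltW.
  exact: wlength_ge0.
have abW := ltW ab.
by rewrite wlength_itv_bnd// (wlength_itv_bnd idfun)// -EFinM lee_fin GK.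
Qed.

(** Adding [C * t] makes [F] nondecreasing, with a Stieltjes measure at most [2 * C] times Lebesgue
    measure. The integral of its Radon-Nikodym density is differentiable at every Lebesgue point,
    and on the interval it differs from [F] by an affine function. *)
Lemma lipschitz_ae_derivable (F : R -> R) (K a b : R) : a < b ->
  (forall s t, `|F s - F t| <= K * `|s - t|) ->
  {ae mu, forall t, a < t < b -> derivable F t 1}.
Proof.
move=> ab FK0.
pose C := `|K| + 1.
have C0 : 0 < C by rewrite /C ltr_pwDr.
have FC s t : `|F s - F t| <= C * `|s - t|.
  apply: (le_trans (FK0 s t)); rewrite ler_wpM2r// /C.
  by rewrite (le_trans (ler_norm K))// lerDl.
pose G0 t := F t + C * t.
have G0nd : nondecreasing G0.
  move=> s t st; rewrite /G0.
  have := FC s t; rewrite (distrC s t) (ger0_norm (_ : 0 <= t - s)) ?subr_ge0//.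
  by move=> /ler_normlP[_ h]; lra.
have G0K s t : s <= t -> G0 t - G0 s <= (2 * C) * (t - s).
  move=> st; rewrite /G0.
  have := FC t s; rewrite (ger0_norm (_ : 0 <= t - s)) ?subr_ge0//.
  by move=> /ler_normlP[_ h]; lra.
have G0rc : forall x, G0 @ at_right x --> G0 x.
  move=> x; apply: cvg_within_filter.
  apply/cvgrPdist_le => e e0; near=> t.
  have h : `|x - t| <= e / (2 * C).
    near: t; apply/nbhs_ballP; exists (e / (2 * C)) => /=.
      by rewrite divr_gt0// mulr_gt0.
    by move=> y; exact: ltW.
  have -> : G0 x - G0 t = F x - F t + C * (x - t) by rewrite /G0; ring.
  apply: (le_trans (ler_normD _ _)).
  rewrite normrM (gtr0_norm C0).
  have := FC x t.
  move: h; rewrite ler_pdivlMr ?mulr_gt0//; lra.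
pose G : cumulative R R := HB.pack G0 (isCumulative.Build R _ R G0 G0nd G0rc).
have C20 : 0 < 2 * C by rewrite mulr_gt0.
have nuK E : (lebesgue_stieltjes_measure G E <= (2 * C)%:E * mu E)%E.
  exact: stieltjes_lipschitz.
pose nu : {measure set (measurableTypeR R) -> \bar R} :=
  lebesgue_stieltjes_measure G.
have nuitv x y : x <= y -> nu `]x, y]%classic = (G0 y - G0 x)%:E.
  move=> xy; rewrite /nu /= /lebesgue_stieltjes_measure /measure_extension.
  by rewrite measurable_mu_extE/= ?wlength_itv_bnd//; exact: is_ocitv.
(* Restriction to a bounded interval makes the measure finite, hence its density integrable. *)
pose D : set (measurableTypeR R) := `]a, b]%classic.
have mD : measurable D by exact: measurable_itv.
have nuD : (nu D < +oo)%E by rewrite nuitv ?ltry// ltW.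
pose nuf : {finite_measure set (measurableTypeR R) -> \bar R} := mfrestr mD nuD.
have dom : nuf `<< mu.
  apply/null_content_dominatesP => E mE E0.
  rewrite /nuf /= /mfrestr /mrestr.
  apply/eqP; rewrite eq_le measure_ge0 andbT.
  apply: (le_trans (nuK _)).
  rewrite (_ : mu (E `&` D) = 0%E) ?mule0//.
  apply/eqP; rewrite eq_le measure_ge0 andbT -E0.
  by apply: le_measure; rewrite ?inE//; exact: measurableI.
pose r := Radon_Nikodym_SigmaFinite.f nuf mu.
have rfin x : r x \is a fin_num by exact: Radon_Nikodym_SigmaFinite.f_fin_num.
have rint : mu.-integrable setT r by exact: Radon_Nikodym_SigmaFinite.f_integrable.
pose f := fine \o r.
have fE : EFin \o f = r by apply/funext => x; rewrite /f /= fineK.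
have fint : mu.-integrable setT (EFin \o f) by rewrite fE.
have locf : locally_integrable setT f.
  by apply: open_integrable_locally => //; exact: openT.
have : {ae mu, forall x, lebesgue_pt f x} by exact: lebesgue_differentiation.
apply: filterS; first exact: (ae_filter_ringOfSetsType mu).
move=> t ft /andP[at' tb].
have intb : mu.-integrable [set` Interval (BRight a) (BRight b)] (EFin \o f).
  by apply: (integrableS measurableT) => //; exact: measurable_itv.
have aBt : (BRight a < BRight t)%O by rewrite bnd_simp.
have [+ _] := @FTC1_lebesgue_pt _ f (BRight a) t b tb intb aBt ft.
set H := (fun y => _) => dH.
have HG y : a < y < b -> H y = G0 y - G0 a.
  move=> /andP[ay yb]; rewrite /H /Rintegral.
  transitivity (fine (nuf `]a, y]%classic)).
    rewrite (Radon_Nikodym_SigmaFinite.f_integral dom); last exact: measurable_itv.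
    by congr fine; apply: eq_integral => x _; rewrite -[RHS]/(r x) -fE.
  rewrite /nuf /= /mfrestr /mrestr setIidl; last first.
    move=> x /=; rewrite /D /= !in_itv/= => /andP[ax xy].
    by rewrite ax (le_trans xy)// ltW.
  by rewrite -/nu nuitv ?ltW.
(* On the open interval this function is [F]. *)
have : derivable (fun y => H y + (G0 a - C * y)) t 1.
  by apply: derivableD => //; exact: derivableB.
apply: near_eq_derivable; near=> y.
rewrite HG ?/G0; first by ring.
by apply/andP; split; near: y; [exact: lt_nbhsr|exact: lt_nbhsl].
Unshelve. all: by end_near. Qed.

Import HBNNSimple.

(* [F] need not be measurable: the positive and negative parts are integrated as
   suprema over simple functions below them. *)
Lemma integral01_ge (F : R -> R) (c : R) : 0 <= c ->
  {ae mu, forall t, 0 < t < 1 -> c <= F t} ->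
  (c%:E <= \int[mu]_(t in `[0%R, 1%R]) (F t)%:E)%E.
Proof.
move=> c0 [N [mN N0 FN]].
pose I : set (measurableTypeR R) := `[0%R, 1%R]%classic.
(* The bound is known on the open interval only, so the endpoints join the exceptional null set. *)
pose Z : set (measurableTypeR R) := N `|` [set 0; 1].
have mZ : measurable Z by apply: measurableU => //; exact: measurableU.
have Z0 : mu Z = 0%E.
  apply/eqP; rewrite eq_le measure_ge0 andbT.
  apply: (le_trans (measureU2 _ _ _)) => //; first exact: measurableU.
  rewrite -[leRHS]adde0; apply: leeD.
    by rewrite le_eqVlt; apply/orP; left; apply/eqP; exact: N0.
  apply: (le_trans (measureU2 _ _ _)) => //.
  rewrite -[leRHS]adde0; apply: leeD; rewrite le_eqVlt; apply/orP; left.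
    exact/eqP/lebesgue_measure_set1.
  exact/eqP/lebesgue_measure_set1.
pose S : set (measurableTypeR R) := I `\` Z.
have mI : measurable I by exact: measurable_itv.
have mS : measurable S by exact: measurableD.
have muS : mu S = 1%:E.
  rewrite /S measureD//=; last first.
    by rewrite /I lebesgue_measure_itv/= lte_fin ltr01 -EFinB ltry.
  rewrite (_ : mu (_ `&` _) = 0%E); last first.
    apply/eqP; rewrite eq_le measure_ge0 andbT -Z0.
    by apply: le_measure; rewrite ?inE//; exact: measurableI.
  by rewrite sube0 /I lebesgue_measure_itv/= lte_fin ltr01 -EFinB subr0.
have FZ t : I t -> ~ Z t -> c <= F t.
  rewrite /I /= in_itv/= => /andP[t0 t1] /not_orP[Nt /not_orP[tn0 tn1]].
  apply: contrapT => h; apply: Nt; apply: FN => /= h'; apply: h; apply: h'.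
  by rewrite !lt_neqAle t0 t1 !andbT; apply/andP; split; apply/eqP => // /esym.
rewrite /integral; set g := (_ \_ _).
(* A simple function below the negative part vanishes off the null set [Z], so it integrates to
   0. *)
rewrite (_ : ereal_sup [set sintegral _ h | h in [set h : {nnsfun measurableTypeR R >-> R} |
    forall x, ((h x)%:E <= g^\- x)%E]] = 0%E); last first.
  apply/eqP; rewrite eq_le; apply/andP; split; last first.
    apply: ereal_sup_ubound; exists nnsfun0; last exact: sintegral0.
    by move=> x; exact: funeneg_ge0.
  apply: ge_ereal_sup => _ [h /= hg <-].
  have h0 t : ~ Z t -> h t = 0%R.
    move=> Zt; apply/eqP; rewrite eq_le fun_ge0 andbT -lee_fin.
    apply: (le_trans (hg t)); rewrite funenegE /g patchE.
    case: ifPn => [|_]; last by rewrite oppe0 maxxx.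
    rewrite inE => It; rewrite ge_max lexx andbT /= lee_fin oppr_le0.
    exact: le_trans (FZ _ It Zt).
  rewrite sintegralE fsbig1// => x _.
  have [->|x0] := eqVneq x 0%R; first by rewrite mul0e.
  rewrite [X in (_ * X)%E](_ : _ = 0%E) ?mule0//.
  apply/eqP; rewrite eq_le measure_ge0 andbT -Z0.
  apply: le_measure; rewrite ?inE//.
  move=> t /= htx; apply: contrapT => /h0 ht0.
  by move/eqP: x0; apply; rewrite -htx.
rewrite sube0.
apply: ereal_sup_ubound.
(* For the positive part, [c] times the indicator of [S] is an admissible simple function, with
   integral [c]. *)
have hE x : indic_nnsfun R mS x = \1_S x by [].
exists (scale_nnsfun (indic_nnsfun R mS) c0).
  move=> x; rewrite [scale_nnsfun _ _ _]/= funeposE le_max /g patchE hE indicE.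
  have [xS|xS] := boolP (x \in S); last by rewrite mulr0 lexx orbT.
  rewrite mulr1; move: xS; rewrite inE => -[Ix Zx].
  by rewrite mem_set//= lee_fin FZ.
rewrite /= sintegralrM/= sintegral_indic.
by rewrite [X in (_ * X)%E](_ : _ = 1%E) ?mule1.
Qed.
End Lebesgue_derivability.

(** * Euclidean inner product and norm on column vectors; limits along ultrafilters *)

Section Euclidean.
Variable R : realType.
Implicit Types m k : nat.

Lemma innerE m (u v : 'cV[R]_m) : inner u v = \sum_i u i ord0 * v i ord0.
Proof. by rewrite /inner mxE; apply: eq_bigr => i _; rewrite mxE. Qed.

Lemma innerC m (u v : 'cV[R]_m) : inner u v = inner v u.
Proof. by rewrite !innerE; apply: eq_bigr => i _; rewrite mulrC. Qed.

Lemma innerDl m (u v w : 'cV[R]_m) : inner (u + v) w = inner u w + inner v w.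
Proof. by rewrite /inner linearD mulmxDl mxE. Qed.

Lemma innerZl m (a : R) (u w : 'cV[R]_m) : inner (a *: u) w = a * inner u w.
Proof. by rewrite /inner linearZ -scalemxAl mxE. Qed.

Lemma innerNl m (u w : 'cV[R]_m) : inner (- u) w = - inner u w.
Proof. by rewrite -scaleN1r innerZl mulN1r. Qed.

Lemma innerBl m (u v w : 'cV[R]_m) : inner (u - v) w = inner u w - inner v w.
Proof. by rewrite innerDl innerNl. Qed.

Lemma innerDr m (u v w : 'cV[R]_m) : inner w (u + v) = inner w u + inner w v.
Proof. by rewrite innerC innerDl !(innerC w). Qed.

Lemma innerZr m (a : R) (u w : 'cV[R]_m) : inner w (a *: u) = a * inner w u.
Proof. by rewrite innerC innerZl innerC. Qed.

Lemma innerBr m (u v w : 'cV[R]_m) : inner w (u - v) = inner w u - inner w v.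
Proof. by rewrite innerC innerBl !(innerC w). Qed.

Lemma inner_trmx m k (A : 'M[R]_(m, k)) u v :
  inner (A *m u) v = inner u (A^T *m v).
Proof. by rewrite /inner trmx_mul -mulmxA. Qed.

Lemma inner_col_mx m k (a a' : 'cV[R]_m) (b b' : 'cV[R]_k) :
  inner (col_mx a b) (col_mx a' b') = inner a a' + inner b b'.
Proof. by rewrite /inner tr_col_mx mul_row_col mxE. Qed.

Lemma inner_ge0 m (u : 'cV[R]_m) : 0 <= inner u u.
Proof. by rewrite innerE sumr_ge0// => i _; rewrite -expr2 sqr_ge0. Qed.

Lemma enormE m (u : 'cV[R]_m) : enorm u = Num.sqrt (inner u u).
Proof.
by rewrite innerE /enorm; congr Num.sqrt; apply: eq_bigr => i _; rewrite expr2.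
Qed.

Lemma enorm_sqr m (u : 'cV[R]_m) : enorm u ^+ 2 = inner u u.
Proof. by rewrite enormE sqr_sqrtr// inner_ge0. Qed.

Lemma enorm_ge0 m (u : 'cV[R]_m) : 0 <= enorm u.
Proof. by rewrite enormE sqrtr_ge0. Qed.

Lemma enormZ m (a : R) (u : 'cV[R]_m) : enorm (a *: u) = `|a| * enorm u.
Proof.
by rewrite !enormE innerZl innerZr mulrA -expr2 sqrtrM ?sqr_ge0// sqrtr_sqr.
Qed.

Lemma enormN m (u : 'cV[R]_m) : enorm (- u) = enorm u.
Proof. by rewrite -scaleN1r enormZ normrN1 mul1r. Qed.

Lemma enormC m (u v : 'cV[R]_m) : enorm (u - v) = enorm (v - u).
Proof. by rewrite -enormN opprB. Qed.

Lemma enorm0 m : enorm (0 : 'cV[R]_m) = 0.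
Proof. by rewrite -(scale0r 0) enormZ normr0 mul0r. Qed.

Lemma coord_le_enorm m (u : 'cV[R]_m) i : `|u i ord0| <= enorm u.
Proof.
rewrite -sqrtr_sqr enormE ler_wsqrtr// innerE (bigD1 i)//= -expr2 lerDl.
by rewrite sumr_ge0// => j _; rewrite -expr2 sqr_ge0.
Qed.

Lemma enorm_eq0 m (u : 'cV[R]_m) : enorm u = 0 -> u = 0.
Proof.
move=> u0; apply/colP => i; rewrite mxE; apply/eqP; rewrite -normr_eq0.
by rewrite eq_le normr_ge0 andbT -u0 coord_le_enorm.
Qed.

Lemma inner0l m (v : 'cV[R]_m) : inner 0 v = 0.
Proof. by rewrite -(scale0r 0) innerZl mul0r. Qed.

Lemma cauchy_schwarz m (u v : 'cV[R]_m) : `|inner u v| <= enorm u * enorm v.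
Proof.
have [v0|v0] := eqVneq (enorm v) 0.
  by rewrite (enorm_eq0 v0) innerC inner0l normr0 enorm0 mulr0.
have vp : 0 < enorm v ^+ 2 by rewrite exprn_gt0// lt_neqAle eq_sym v0 enorm_ge0.
rewrite -(@ler_pXn2r _ 2)// ?nnegrE ?mulr_ge0 ?enorm_ge0//.
rewrite -normrX ger0_norm ?sqr_ge0// exprMn.
have := inner_ge0 (enorm v ^+ 2 *: u - inner u v *: v).
rewrite innerBl !innerBr !innerZl !innerZr (innerC v u) -!enorm_sqr.
set b := enorm v ^+ 2 in vp *; set a := enorm u ^+ 2; set c := inner u v.
move=> h; suff : 0 <= b * (a * b - c ^+ 2) by rewrite pmulr_rge0// subr_ge0.
by apply: le_trans h _; rewrite le_eqVlt; apply/orP; left; apply/eqP; ring.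
Qed.

Lemma inner_le m (u v : 'cV[R]_m) : inner u v <= enorm u * enorm v.
Proof. exact: le_trans (ler_norm _) (cauchy_schwarz u v). Qed.

Lemma enormD m (u v : 'cV[R]_m) : enorm (u + v) <= enorm u + enorm v.
Proof.
rewrite -(@ler_pXn2r _ 2)// ?nnegrE ?addr_ge0 ?enorm_ge0//.
rewrite enorm_sqr innerDl !innerDr (innerC v u) -!enorm_sqr sqrrD.
have := inner_le u v; lra.
Qed.

Lemma enormB m (u v : 'cV[R]_m) : enorm (u - v) <= enorm u + enorm v.
Proof. by rewrite -(enormN v) enormD. Qed.

Lemma enorm_triangle m (w u v : 'cV[R]_m) :
  enorm (u - v) <= enorm (u - w) + enorm (w - v).
Proof. by rewrite -[u - v](subrKA w) enormD. Qed.

Lemma enorm_le_sum m (u : 'cV[R]_m) : enorm u <= \sum_i `|u i ord0|.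
Proof.
rewrite -(@ler_pXn2r _ 2)// ?nnegrE ?sumr_ge0 ?enorm_ge0//.
rewrite enorm_sqr innerE expr2 mulr_suml; apply: ler_sum => i _.
rewrite -expr2 -[_ ^+ 2]ger0_norm ?sqr_ge0// expr2 normrM ler_wpM2l//.
by rewrite (bigD1 i)//= lerDl sumr_ge0.
Qed.

Lemma enorm_col_mx m k (a : 'cV[R]_m) (b : 'cV[R]_k) :
  enorm (col_mx a b) ^+ 2 = enorm a ^+ 2 + enorm b ^+ 2.
Proof. by rewrite !enorm_sqr inner_col_mx. Qed.

Lemma enorm_usubmx m k (z : 'cV[R]_(m + k)) : enorm (usubmx z) <= enorm z.
Proof.
rewrite -(@ler_pXn2r _ 2)// ?nnegrE ?enorm_ge0// -[in leRHS](vsubmxK z).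
by rewrite enorm_col_mx lerDl sqr_ge0.
Qed.

Lemma enorm_dsubmx m k (z : 'cV[R]_(m + k)) : enorm (dsubmx z) <= enorm z.
Proof.
rewrite -(@ler_pXn2r _ 2)// ?nnegrE ?enorm_ge0// -[in leRHS](vsubmxK z).
by rewrite enorm_col_mx lerDr sqr_ge0.
Qed.

Lemma enorm_col_mx_le m k (a : 'cV[R]_m) (b : 'cV[R]_k) :
  enorm (col_mx a b) <= enorm a + enorm b.
Proof.
rewrite -(@ler_pXn2r _ 2)// ?nnegrE ?addr_ge0 ?enorm_ge0// enorm_col_mx sqrrD.
have := mulr_ge0 (enorm_ge0 a) (enorm_ge0 b); lra.
Qed.

Lemma enorm_mulmx_bound m k (A : 'M[R]_(m, k)) :
  exists2 C, 0 <= C & forall v, enorm (A *m v) <= C * enorm v.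
Proof.
exists (\sum_i enorm (row i A)^T); first by rewrite sumr_ge0// => i _; exact: enorm_ge0.
move=> v; apply: (le_trans (enorm_le_sum _)); rewrite mulr_suml.
apply: ler_sum => i _; apply: le_trans (cauchy_schwarz _ _).
by rewrite innerE mxE le_eqVlt; apply/orP; left; apply/eqP; congr `|_|;
  apply: eq_bigr => j _; rewrite !mxE.
Qed.

Lemma opnorm_mulmx m k (A : 'M[R]_(m, k)) v :
  enorm (A *m v) <= opnorm A * enorm v.
Proof.
have [v0|v0] := eqVneq (enorm v) 0.
  by rewrite (enorm_eq0 v0) mulmx0 !enorm0 mulr0.
have vp : 0 < enorm v by rewrite lt_neqAle eq_sym v0 enorm_ge0.
rewrite -ler_pdivrMr// mulrC.
have -> : (enorm v)^-1 * enorm (A *m v) = enorm (A *m ((enorm v)^-1 *: v)).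
  by rewrite -scalemxAr enormZ ger0_norm// invr_ge0 ltW.
apply: ub_le_sup; last first.
  exists ((enorm v)^-1 *: v) => //=.
  by rewrite enormZ ger0_norm ?mulVf// invr_ge0 ltW.
(* The supremum defining [opnorm] dominates its members only once its set is known to be bounded. *)
have [C C0 AC] := enorm_mulmx_bound A.
exists C => _ [u /= u1 <-]; apply: (le_trans (AC u)).
by rewrite -[leRHS]mulr1 ler_wpM2l.
Qed.

(** The squared norm of [A^T *m w] is the inner product of [A *m (A^T *m w)] with [w]. *)
Lemma trmx_bound m k (A : 'M[R]_(m, k)) C : 0 <= C ->
  (forall v, enorm (A *m v) <= C * enorm v) ->
  forall w, enorm (A^T *m w) <= C * enorm w.
Proof.
move=> C0 AC w; have [w0|w0] := eqVneq (enorm (A^T *m w)) 0.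
  by rewrite w0 mulr_ge0// enorm_ge0.
have wp : 0 < enorm (A^T *m w) by rewrite lt_neqAle eq_sym w0 enorm_ge0.
rewrite -(ler_pM2l wp) -expr2 enorm_sqr -inner_trmx.
apply: (le_trans (inner_le _ _)).
rewrite (le_trans (ler_wpM2r (enorm_ge0 w) (AC _)))//.
by rewrite mulrCA mulrA.
Qed.

Lemma normr_le_enorm m (u : 'cV[R]_m) : `|u| <= enorm u.
Proof.
rewrite [leLHS]/Num.Def.normr/= mx_normrE; apply: bigmax_le => [|[i j] _].
  exact: enorm_ge0.
by rewrite /= ord1 coord_le_enorm.
Qed.

Lemma coord_le_normr m (u : 'cV[R]_m) i : `|u i ord0| <= `|u|.
Proof.
rewrite [leRHS]/Num.Def.normr/= mx_normrE.
exact: (@le_bigmax _ _ _ _ (fun ij => `|u ij.1 ij.2|) (i, ord0)).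
Qed.

Lemma enorm_le_normr m (u : 'cV[R]_m) : enorm u <= m%:R * `|u|.
Proof.
apply: (le_trans (enorm_le_sum u)).
apply: (@le_trans _ _ (\sum_(i < m) `|u|)).
  by apply: ler_sum => i _; exact: coord_le_normr.
by rewrite sumr_const card_ord mulr_natl.
Qed.

(** The topology on column vectors comes from the max norm; this passes to [enorm]. *)
Lemma cvg_enormP (T : Type) (F : set_system T) (FF : Filter F) m
    (v : T -> 'cV[R]_m) (l : 'cV[R]_m) :
  v @ F --> l <-> forall e, 0 < e -> \forall j \near F, enorm (v j - l) < e.
Proof.
split => [/cvgrPdist_lt vl e e0|vl].
  (* [m.+1] rather than [m], because the dimension may be 0. *)
  have e1 : 0 < e / m.+1%:R by rewrite divr_gt0.
  move: (vl _ e1); apply: filterS => j.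
  rewrite ltr_pdivlMr// distrC => h; apply: le_lt_trans h.
  apply: (le_trans (enorm_le_normr _)); rewrite mulrC ler_wpM2l//.
  by rewrite ler_nat.
apply/cvgrPdist_lt => e e0; move: (vl _ e0); apply: filterS => j.
by rewrite distrC; apply: le_lt_trans; exact: normr_le_enorm.
Qed.

(** Each coordinate stays in a compact segment, where a cluster point along an ultrafilter is a
    limit. The same [U] serves any family of bounded sequences. *)
Lemma ultra_cvg_bounded (U : set_system nat) m (v : nat -> 'cV[R]_m) B :
  UltraFilter U -> (forall j, enorm (v j) <= B) ->
  exists l, forall e, 0 < e -> \forall j \near U, enorm (v j - l) < e.
Proof.
move=> UU vB.
have coord i : exists li : R, v j i ord0 @[j --> U] --> li.
  have UI : (v j i ord0 @[j --> U]) `[- B, B]%classic.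
    change (U ((fun j => v j i ord0) @^-1` `[- B, B]%classic)).
    apply: filterE => j /=; rewrite in_itv/=.
    by have := le_trans (coord_le_enorm (v j) i) (vB j); rewrite ler_norml.
  have [li [_ cl]] := @segment_compact R (- B) B _ _ UI.
  exists li; apply/cvgrPdist_lt => e e0.
  have [//|UA] := in_ultra_setVsetC [set j | `|li - v j i ord0| < e] UU.
  have [y [/= yA yB]] := cl [set y | ~ (`|li - y| < e)] _ UA (nbhsx_ballx li e e0).
  by case: (yA yB).
have [l lP] := choice coord.
exists (\col_i l i) => e e0.
have e1 : 0 < e / m.+1%:R by rewrite divr_gt0.
have : \forall j \near U, forall i, `|v j i ord0 - l i| < e / m.+1%:R.
  apply: filter_forall => i.
  have /cvgrPdist_lt/(_ _ e1) := lP i.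
  by apply: filterS => j; rewrite distrC.
apply: filterS => j h; apply: (le_lt_trans (enorm_le_sum _)).
apply: (@le_lt_trans _ _ (\sum_(i < m) e / m.+1%:R)).
  by apply: ler_sum => i _; rewrite !mxE ltW.
rewrite sumr_const card_ord -[_ *+ m]mulr_natr -mulrA gtr_pMr//.
by rewrite mulrC ltr_pdivrMr// mul1r ltr_nat.
Qed.

End Euclidean.

(** * Mean values, symmetry of the Hessian, and Taylor bounds for [grady] *)

Section Calculus.
Variable R : realType.

(** A directional derivative sees only the restriction to a line; partial derivatives and
    derivatives of the joint map are thus exchanged without a chain rule. *)
Lemma derive_reparam (V V' W : normedModType R) (F : V -> W) (F' : V' -> W)
    (a v : V) (a' v' : V') :
  (forall h : R, F (h *: v + a) = F' (h *: v' + a')) ->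
  (derivable F a v <-> derivable F' a' v') /\ 'D_v F a = 'D_v' F' a'.
Proof.
move=> FF'; rewrite /derivable /derive.
have F0 : F a = F' a' by have := FF' 0; rewrite !scale0r !add0r.
suff -> : (fun h : R => h^-1 *: ((F \o shift a) (h *: v) - F a)) =
  (fun h : R => h^-1 *: ((F' \o shift a') (h *: v') - F' a')) by [].
by apply/funext => h /=; rewrite FF' F0.
Qed.

Lemma MVT_line (V : normedModType R) (F : V -> R) (a v : V) (s : R) : 0 < s ->
  (forall t, derivable F (a + t *: v) v) ->
  exists2 c, 0 < c < s & F (a + s *: v) - F a = s * 'D_v F (a + c *: v).
Proof.
move=> s0 dF.
pose phi (t : R) := F (a + t *: v).
have dphi (t : R) : is_derive t 1 phi ('D_v F (a + t *: v)).
  have [|h1 h2] := @derive_reparam _ _ _ phi F t 1 (a + t *: v) v.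
    by move=> h; rewrite /phi [h *: 1]mulr1 scalerDl addrCA.
  by apply: DeriveDef => //; apply/h1.
have cphi : {within `[0, s]%classic, continuous phi}.
  by apply: derivable_within_continuous => t _; exact: ex_derive.
have [c] := MVT s0 (fun t _ => dphi t) cphi.
rewrite in_itv/= => c0s; rewrite /phi scale0r addr0 subr0 mulrC => h.
by exists c.
Qed.

(* Schwarz: the second difference quotient equals either mixed derivative at some nearby point. *)
Lemma mixed_derivatives (m : nat) (G : 'cV[R]_m -> R) (a b : 'cV[R]_m)
    (Dab Dba : 'cV[R]_m -> R) (y : 'cV[R]_m) (C : R) : 0 <= C ->
  (forall y, derivable G y a) -> (forall y, derivable G y b) ->
  (forall y, is_derive y b (fun y => 'D_a G y) (Dab y)) ->
  (forall y, is_derive y a (fun y => 'D_b G y) (Dba y)) ->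
  (forall y1 y2, `|Dab y1 - Dab y2| <= C * enorm (y1 - y2)) ->
  (forall y1 y2, `|Dba y1 - Dba y2| <= C * enorm (y1 - y2)) ->
  Dab y = Dba y.
Proof.
move=> C0 dGa dGb dab dba Cab Cba.
have quot (e1 e2 : 'cV[R]_m) (D12 : 'cV[R]_m -> R) (s : R) : 0 < s ->
    (forall y, derivable G y e1) ->
    (forall y, is_derive y e2 (fun y => 'D_e1 G y) (D12 y)) ->
    exists c1 c2, [/\ 0 < c1 < s, 0 < c2 < s &
      G (y + s *: e1 + s *: e2) - G (y + s *: e1) - (G (y + s *: e2) - G y) =
      s * (s * D12 (y + c1 *: e1 + c2 *: e2))].
  move=> s0 d1 d12.
  pose F y' := G (y' + s *: e2) - G y'.
  have dF y' : is_derive y' e1 F ('D_e1 G (y' + s *: e2) - 'D_e1 G y').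
    apply: is_deriveB; last by apply: DeriveDef.
    have [|h1 h2] := @derive_reparam _ _ _ (fun y' => G (y' + s *: e2)) G
      y' e1 (y' + s *: e2) e1; first by move=> h; rewrite addrA.
    by apply: DeriveDef => //; apply/h1.
  have [c1 c1s] := @MVT_line _ F y e1 s s0
    (fun t => @ex_derive _ _ _ _ _ _ _ (dF _)).
  rewrite (@derive_val _ _ _ _ _ _ _ (dF _)) /F => ->.
  have [c2 c2s ->] := @MVT_line _ (fun y => 'D_e1 G y) (y + c1 *: e1) e2 s s0
    (fun t => @ex_derive _ _ _ _ _ _ _ (d12 _)).
  by rewrite (@derive_val _ _ _ _ _ _ _ (d12 _)); exists c1, c2.

apply/eqP; rewrite -subr_eq0 -normr_le0.
apply/ler_addgt0Pr => e e0; rewrite add0r.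
(* Both evaluation points are within [s * (enorm a + enorm b)] of [y], so the two Lipschitz errors
   together stay below [s * M = e]. *)
pose M := 2 * (C * (enorm a + enorm b)) + 1.
have M0 : 0 < M by rewrite /M ltr_pwDr// !mulr_ge0// addr_ge0// enorm_ge0.
pose s := e / M; have s0 : 0 < s by rewrite divr_gt0.
have [c1 [c2 [/andP[c10 c1s] /andP[c20 c2s] E1]]] := quot a b Dab s s0 dGa dab.
have [k1 [k2 [/andP[k10 k1s] /andP[k20 k2s] E2]]] := quot b a Dba s s0 dGb dba.
have E : Dab (y + c1 *: a + c2 *: b) = Dba (y + k1 *: b + k2 *: a).
  have sn0 : s != 0 by rewrite gt_eqF.
  apply: (mulfI sn0); apply: (mulfI sn0); rewrite -E1 -E2.
  by rewrite (addrAC y); ring.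
have near1 (D : 'cV[R]_m -> R) (p q : 'cV[R]_m) (h1 h2 : R) :
    0 < h1 -> h1 < s -> 0 < h2 -> h2 < s ->
    (forall y1 y2, `|D y1 - D y2| <= C * enorm (y1 - y2)) ->
    `|D y - D (y + h1 *: p + h2 *: q)| <= s * (C * (enorm p + enorm q)).
  move=> h10 h1s h20 h2s DC; apply: (le_trans (DC _ _)).
  rewrite enormC addrC -!addrA addKr.
  rewrite mulrCA ler_wpM2l// mulrDr (le_trans (enormD _ _))// !enormZ.
  by apply: lerD; rewrite gtr0_norm// ler_wpM2r ?enorm_ge0// ltW.
have B1 := near1 Dab a b c1 c2 c10 c1s c20 c2s Cab.
have B2 := near1 Dba b a k1 k2 k10 k1s k20 k2s Cba.
have -> : Dab y - Dba y = (Dab y - Dab (y + c1 *: a + c2 *: b)) -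
   (Dba y - Dba (y + k1 *: b + k2 *: a)) by rewrite E; ring.
rewrite (le_trans (ler_normB _ _))// (le_trans (lerD B1 B2))//.
have sM : s * M = e by rewrite /s divfK// gt_eqF.
rewrite -sM /M; set X := C * (enorm a + enorm b).
rewrite (_ : C * (enorm b + enorm a) = X) ?(addrC (enorm b))//.
have : 0 <= s by exact: ltW.
lra.
Qed.

Variables (n p : nat) (g : 'cV[R]_n -> 'cV[R]_p -> R).
Hypothesis dg : forall z, differentiable (joint g) z.
Hypothesis dgg : forall z, differentiable (gradg g) z.

Lemma gradg_grady x y i :
  gradg g (col_mx x y) (rshift n i) ord0 = grady g x y i ord0.
Proof. by rewrite /gradg col_mxKu col_mxKd col_mxEd. Qed.

Lemma derivable_g x y v : derivable (g x) y v.
Proof.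
have [|h _] := @derive_reparam _ _ _ (g x) (joint g) y v (col_mx x y) (col_mx 0 v).
  by move=> h; rewrite /joint scale_col_mx add_col_mx scaler0 add0r col_mxKu col_mxKd.
by apply/h; exact: diff_derivable.
Qed.

Lemma derive_grady_y x y i v :
  (derivable (fun y' => grady g x y' i ord0) y v <->
   derivable (fun z => gradg g z (rshift n i) ord0) (col_mx x y) (col_mx 0 v)) /\
  'D_v (fun y' => grady g x y' i ord0) y =
  'D_(col_mx 0 v) (fun z => gradg g z (rshift n i) ord0) (col_mx x y).
Proof.
apply: derive_reparam => h.
by rewrite scale_col_mx add_col_mx scaler0 add0r gradg_grady.
Qed.

Lemma derive_grady_x x y i v :
  'D_v (fun x' => grady g x' y i ord0) x =
  'D_(col_mx v 0) (fun z => gradg g z (rshift n i) ord0) (col_mx x y).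
Proof.
have [|_ //] := @derive_reparam _ _ _ (fun x' => grady g x' y i ord0)
  (fun z => gradg g z (rshift n i) ord0) x v (col_mx x y) (col_mx v 0) => h.
by rewrite scale_col_mx add_col_mx scaler0 add0r gradg_grady.
Qed.

Lemma derivable_gradg z i v : derivable (fun z => gradg g z i ord0) z v.
Proof. by move: i ord0; apply/derivable_mxP; exact: diff_derivable. Qed.

Lemma derive_gradg z i v : 'D_v (fun z => gradg g z i ord0) z = 'd (gradg g) z v i ord0.
Proof.
have := @derive_mx _ _ _ _ (gradg g) z v
  (@diff_derivable _ _ _ _ _ _ (dgg z)).
by rewrite deriveE// => ->; rewrite mxE.
Qed.

(** The Hessian blocks are defined entrywise by partial derivatives, so the direction is expanded in
    the standard basis and linearity of the differential of [gradg] is used. *)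
Lemma derive_gradg_Hessian x y dx dy i :
  'D_(col_mx dx dy) (fun z => gradg g z (rshift n i) ord0) (col_mx x y) =
  (Hyx g x y *m dx + Hyy g x y *m dy) i ord0.
Proof.
have -> : col_mx dx dy = \sum_k dx k ord0 *: col_mx (e_vec R k) 0 +
    \sum_j dy j ord0 *: col_mx 0 (e_vec R j) :> 'cV[R]_(n + p).
  have coldelta q (v : 'cV[R]_q) : v = \sum_k v k ord0 *: e_vec R k.
    rewrite {1}(matrix_sum_delta v); apply: eq_bigr => k _.
    by rewrite big_ord1.
  rewrite {1}(coldelta _ dx) {1}(coldelta _ dy).
  have -> (a : 'cV[R]_n) (b : 'cV[R]_p) : col_mx a b = col_mx a 0 + col_mx 0 b.
    by rewrite add_col_mx addr0 add0r.
  congr (_ + _).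
    elim/big_ind2 : _ => [|a b c e <- <-|k _]; first by rewrite col_mx0.
      by rewrite add_col_mx addr0.
    by rewrite scale_col_mx scaler0.
  elim/big_ind2 : _ => [|a b c e <- <-|k _]; first by rewrite col_mx0.
    by rewrite add_col_mx addr0.
  by rewrite scale_col_mx scaler0.
rewrite derive_gradg linearD !linear_sum !mxE /= !summxE; congr (_ + _).
  apply: eq_bigr => k _; rewrite linearZ !mxE mulrC; congr (_ * _).
  by rewrite derive_grady_x derive_gradg.
apply: eq_bigr => k _; rewrite linearZ !mxE mulrC; congr (_ * _).
by rewrite (derive_grady_y _ _ _ _).2 derive_gradg.
Qed.

Variables (Lg Qg : R).
Hypotheses (Lg0 : 0 < Lg) (Qg0 : 0 < Qg).
Hypothesis gradL : forall x1 y1 x2 y2,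
  enorm (gradg g (col_mx x1 y1) - gradg g (col_mx x2 y2))
    <= Lg * enorm (col_mx x1 y1 - col_mx x2 y2).
Hypothesis HyyQ : forall x1 y1 x2 y2,
  opnorm (Hyy g x1 y1 - Hyy g x2 y2) <= Qg * enorm (col_mx x1 y1 - col_mx x2 y2).
Hypothesis HxyQ : forall x1 y1 x2 y2,
  opnorm (Hxy g x1 y1 - Hxy g x2 y2) <= Qg * enorm (col_mx x1 y1 - col_mx x2 y2).

Lemma Hyy_lip x1 y1 x2 y2 v : enorm ((Hyy g x1 y1 - Hyy g x2 y2) *m v) <=
  Qg * enorm (col_mx x1 y1 - col_mx x2 y2) * enorm v.
Proof.
by apply: (le_trans (opnorm_mulmx _ _)); rewrite ler_wpM2r ?enorm_ge0.
Qed.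

Lemma Hxy_lip x1 y1 x2 y2 v : enorm ((Hxy g x1 y1 - Hxy g x2 y2) *m v) <=
  Qg * enorm (col_mx x1 y1 - col_mx x2 y2) * enorm v.
Proof.
by apply: (le_trans (opnorm_mulmx _ _)); rewrite ler_wpM2r ?enorm_ge0.
Qed.

Lemma Hyx_lip x1 y1 x2 y2 v : enorm ((Hyx g x1 y1 - Hyx g x2 y2) *m v) <=
  Qg * enorm (col_mx x1 y1 - col_mx x2 y2) * enorm v.
Proof.
rewrite /Hyx -linearB; apply: trmx_bound => [|w]; last exact: Hxy_lip.
by rewrite mulr_ge0 ?enorm_ge0// ltW.
Qed.

Lemma enorm_e_vec m (i : 'I_m) : enorm (e_vec R i : 'cV[R]_m) = 1.
Proof.
rewrite /enorm (bigD1 i)//= big1 ?addr0 => [|j ji].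
  by rewrite /e_vec mxE !eqxx expr1n sqrtr1.
by rewrite /e_vec mxE (negbTE ji) expr0n.
Qed.

(** The operator-norm Lipschitz bound, tested on basis vectors, makes every entry of [Hyy]
    Lipschitz, as [mixed_derivatives] requires. *)
Lemma Hyy_sym x y : (Hyy g x y)^T = Hyy g x y.
Proof.
have gE i : (fun y' => grady g x y' i ord0) = 'D_(e_vec R i) (g x).
  by apply/funext => y'; rewrite mxE.
have dH i j y' : is_derive y' (e_vec R j) ('D_(e_vec R i) (g x)) (Hyy g x y' i j).
  apply: DeriveDef; last by rewrite mxE gE.
  by rewrite -gE; apply/(derive_grady_y _ _ _ _).1; exact: derivable_gradg.
have HQ i j y1 y2 : `|Hyy g x y1 i j - Hyy g x y2 i j| <= Qg * enorm (y1 - y2).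
  have -> : Hyy g x y1 i j - Hyy g x y2 i j =
      ((Hyy g x y1 - Hyy g x y2) *m e_vec R j) i ord0.
    by rewrite /e_vec -colE !mxE.
  apply: (le_trans (coord_le_enorm _ _)); apply: (le_trans (Hyy_lip _ _ _ _ _)).
  rewrite enorm_e_vec mulr1 ler_wpM2l ?(ltW Qg0)// opp_col_mx add_col_mx subrr.
  by rewrite (le_trans (enorm_col_mx_le _ _))// enorm0 add0r.
apply/matrixP => i j; rewrite mxE.
by apply: (@mixed_derivatives _ (g x) (e_vec R j) (e_vec R i)
  (fun y => Hyy g x y j i) (fun y => Hyy g x y i j) y Qg (ltW Qg0)) => // y';
  exact: derivable_g.
Qed.

(** The mean value theorem yields an intermediate point that depends on the coordinate, whence the
    factor [p]; the 2 counts the blocks [Hyx] and [Hyy]. *)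
Lemma grady_taylor x y dx dy :
  enorm (grady g (x + dx) (y + dy) - grady g x y
         - (Hyx g x y *m dx + Hyy g x y *m dy))
  <= p%:R * (2 * Qg) * enorm (col_mx dx dy) ^+ 2.
Proof.
apply: (le_trans (enorm_le_sum _)).
rewrite -mulrA mulr_natl -[X in _ *+ X]card_ord -sumr_const.
apply: ler_sum => i _.
have [c /andP[c0 c1]] := @MVT_line _ (fun z => gradg g z (rshift n i) ord0)
  (col_mx x y) (col_mx dx dy) 1 ltr01 (fun t => @derivable_gradg _ _ _).
rewrite scale1r mul1r scale_col_mx !add_col_mx derive_gradg_Hessian !gradg_grady => E.
set J := Hyx g (x + c *: dx) (y + c *: dy) *m dx +
  Hyy g (x + c *: dx) (y + c *: dy) *m dy in E.
set J' := Hyx g x y *m dx + Hyy g x y *m dy.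
have -> : (grady g (x + dx) (y + dy) - grady g x y - J') i ord0 =
    (J - J') i ord0.
  by rewrite [LHS]mxE [RHS]mxE; congr (_ + _); rewrite -E !mxE.
apply: (le_trans (coord_le_enorm _ _)).
have -> : J - J' = (Hyx g (x + c *: dx) (y + c *: dy) - Hyx g x y) *m dx +
   (Hyy g (x + c *: dx) (y + c *: dy) - Hyy g x y) *m dy.
  by rewrite !mulmxBl addrACA -opprD.
have dz : enorm (col_mx (x + c *: dx) (y + c *: dy) - col_mx x y) <=
    enorm (col_mx dx dy).
  rewrite opp_col_mx add_col_mx (addrC x) (addrC y) !addrK -scale_col_mx enormZ.
  by rewrite gtr0_norm// ler_piMl ?enorm_ge0// ltW.
have Q0 := ltW Qg0; have z0 := enorm_ge0 (col_mx dx dy).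
have bnd q (v : 'cV[R]_q) : enorm v <= enorm (col_mx dx dy) ->
  Qg * enorm (col_mx (x + c *: dx) (y + c *: dy) - col_mx x y) * enorm v <=
  Qg * enorm (col_mx dx dy) ^+ 2.
  move=> vz; rewrite -mulrA ler_wpM2l// expr2.
  by apply: ler_pM => //; exact: enorm_ge0.
have := enorm_usubmx (col_mx dx dy); have := enorm_dsubmx (col_mx dx dy).
rewrite col_mxKu col_mxKd => /bnd b2 /bnd b1.
rewrite (le_trans (enormD _ _))//.
rewrite (le_trans (lerD (Hyx_lip _ _ _ _ _) (Hyy_lip _ _ _ _ _)))//.
lra.
Qed.

Lemma grady_lip x1 y1 x2 y2 : enorm (grady g x1 y1 - grady g x2 y2) <=
  Lg * enorm (col_mx x1 y1 - col_mx x2 y2).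
Proof.
apply: le_trans (gradL _ _ _ _).
rewrite /gradg !col_mxKu !col_mxKd opp_col_mx add_col_mx.
by apply: le_trans (enorm_dsubmx _); rewrite col_mxKd.
Qed.

(** The increment is scaled by a small [s]: the Lipschitz bound scales like [s], the Taylor
    remainder like its square. Setting one of [dx], [dy] to 0 then bounds each block by [Lg]. *)
Lemma grady_jacobian_bound x y dx dy :
  enorm (Hyx g x y *m dx + Hyy g x y *m dy) <= Lg * enorm (col_mx dx dy).
Proof.
set J := _ + _; set D := enorm (col_mx dx dy).
set C := p%:R * (2 * Qg) * D ^+ 2.
have C0 : 0 <= C by rewrite mulr_ge0 ?sqr_ge0// mulr_ge0// mulr_ge0// ltW.
apply/ler_addgt0Pr => e e0.
pose s := e / (C + 1).
have C1 : 0 < C + 1 by rewrite ltr_pwDr.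
have s0 : 0 < s by rewrite divr_gt0.
have sC : s * C <= e.
  by rewrite /s mulrAC ler_pdivrMr// ler_pM2l// lerDl ler01.
have := grady_taylor x y (s *: dx) (s *: dy).
have := grady_lip (x + s *: dx) (y + s *: dy) x y.
rewrite opp_col_mx add_col_mx (addrC x) (addrC y) !addrK.
rewrite -!scalemxAr -scalerDr -/J -scale_col_mx enormZ (gtr0_norm s0) -/D.
set d := (_ - grady g x y) => h1 h2.
have : s * enorm J <= s * (Lg * D + e).
  rewrite -{1}(gtr0_norm s0) -enormZ -[s *: J](subKr d).
  rewrite (le_trans (enormB _ _))// mulrDr.
  apply: lerD; first by rewrite mulrCA.
  apply: (le_trans h2); rewrite exprMn mulrCA -/C expr2 -mulrA.
  by rewrite ler_wpM2l// ltW.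
by rewrite ler_pM2l.
Qed.

Lemma Hyy_bound x y v : enorm (Hyy g x y *m v) <= Lg * enorm v.
Proof.
have := grady_jacobian_bound x y 0 v; rewrite mulmx0 add0r => /le_trans; apply.
rewrite ler_wpM2l ?(ltW Lg0)// (le_trans (enorm_col_mx_le _ _))//.
by rewrite enorm0 add0r.
Qed.

Lemma Hyx_bound x y v : enorm (Hyx g x y *m v) <= Lg * enorm v.
Proof.
have := grady_jacobian_bound x y v 0; rewrite mulmx0 addr0 => /le_trans; apply.
rewrite ler_wpM2l ?(ltW Lg0)// (le_trans (enorm_col_mx_le _ _))//.
by rewrite enorm0 addr0.
Qed.

Lemma Hxy_bound x y v : enorm (Hxy g x y *m v) <= Lg * enorm v.
Proof.
rewrite -[Hxy g x y]trmxK; apply: trmx_bound; first exact: ltW.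
exact: Hyx_bound.
Qed.

End Calculus.

(** * A perturbed iteration driven by a conservative field *)

Section Inclusion.
Variables (R : realType) (m : nat).
Variables (F : 'cV[R]_m -> R) (D : 'cV[R]_m -> set 'cV[R]_m).
Variable (Lz : 'cV[R]_m -> 'cV[R]_m -> 'cV[R]_m) (M C1 C2 : R).
Hypotheses (M0 : 0 < M) (C10 : 0 <= C1) (C20 : 0 <= C2).
Hypothesis Dclosed : closed [set q : 'cV[R]_m * 'cV[R]_m | D q.1 q.2].
Hypothesis Dne : forall z, D z !=set0.
Hypothesis Dconv : forall z, convex_subset (D z).
Hypothesis Dbd : forall z v, D z v -> enorm v <= M.
Hypothesis LzD : forall z a d b d',
  Lz z (a *: d + b *: d') = a *: Lz z d + b *: Lz z d'.
Hypothesis Lz_bd : forall z d, enorm (Lz z d) <= C1 * enorm d.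
Hypothesis Lz_lip : forall z z' d,
  enorm (Lz z d - Lz z' d) <= C2 * enorm (z - z') * enorm d.

Lemma LzB z d d' : Lz z (d - d') = Lz z d - Lz z d'.
Proof. by have := LzD z 1 d (-1) d'; rewrite !scaleN1r !scale1r. Qed.

(** Bounded values make the selections converge along [U]; the closed graph keeps the limit in
    [D zeta]. *)
Lemma ultra_limit_field (U : set_system nat) (qs ds : nat -> 'cV[R]_m) zeta :
  UltraFilter U ->
  (forall e, 0 < e -> \forall j \near U, enorm (qs j - zeta) < e) ->
  (forall j, D (qs j) (ds j)) ->
  exists2 d, D zeta d & forall e, 0 < e -> \forall j \near U, enorm (ds j - d) < e.
Proof.
move=> UU qz Dq.
have [d dP] := ultra_cvg_bounded UU (fun j => Dbd (Dq j)).
exists d => //.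
have cq : qs @ U --> zeta by apply/cvg_enormP.
have cd : ds @ U --> d by apply/cvg_enormP.
apply: (Dclosed (t := (zeta, d))) => A nA.
have UA : U [set j | A (qs j, ds j)] by exact: (cvg_pair cq cd).
by have [j jA] := filter_ex UA; exists (qs j, ds j); split => //; exact: Dq.
Qed.

Lemma ultra_nat : exists U : set_system nat, UltraFilter U /\
  (forall K, \forall j \near U, (K <= j)%N).
Proof.
have [U [UU oU]] := @ultraFilterLemma nat \oo _.
by exists U; split => // K; apply: oU; exact: nbhs_infty_ge.
Qed.

Lemma invS_small (U : set_system nat) (e : R) : ProperFilter U ->
  (forall K, \forall j \near U, (K <= j)%N) -> 0 < e ->
  \forall j \near U, j.+1%:R^-1 < e.
Proof.
move=> UU Uoo e0.
have : \forall j \near \oo, `|0 - harmonic j : R| < e.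
  by have /cvgrPdist_lt := @cvg_harmonic R; apply.
move=> [K _ KP]; apply: filterS (Uoo K) => j /KP /=.
by rewrite sub0r normrN ger0_norm// invr_ge0.
Qed.

Lemma field_usc zeta e : 0 < e -> exists2 del, 0 < del & forall q d,
  enorm (q - zeta) < del -> D q d -> exists2 d', D zeta d' & enorm (d - d') < e.
Proof.
move=> e0; apply: contrapT => h.
have h' (i : nat) : exists qd : 'cV[R]_m * 'cV[R]_m,
    [/\ enorm (qd.1 - zeta) < i.+1%:R^-1, D qd.1 qd.2 &
     forall d', D zeta d' -> e <= enorm (qd.2 - d')].
  apply: contrapT => h1; apply: h; exists i.+1%:R^-1 => [|q d qz Dqd].
    by rewrite invr_gt0.
  apply: contrapT => h2; apply: h1; exists (q, d); split => //= d' Dd'.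
  by rewrite leNgt; apply/negP => h3; apply: h2; exists d'.
have [qd qdP] := choice h'.
have [U [UU Uoo]] := ultra_nat.
have [|j|d Dd dP] := @ultra_limit_field U (fun i => (qd i).1) (fun i => (qd i).2)
    zeta UU.
- move=> e1 e10; apply: filterS (invS_small _ Uoo e10) => j.
  by apply: lt_trans; case: (qdP j).
- by case: (qdP j).
have [j jP] := filter_ex (dP e e0).
by have [_ _ /(_ _ Dd)] := qdP j; rewrite leNgt jP.
Qed.

(** Without a gap, elements of [D] at points tending to [zeta], with pairings below any positive
    bound, would have a limit in [D zeta] whose pairing is not positive. *)
Lemma noncritical_gap zeta : (forall d, D zeta d -> 0 < inner (Lz zeta d) d) ->
  exists c rho, [/\ 0 < c, 0 < rho & forall z d,
    enorm (z - zeta) < rho -> D z d -> c <= inner (Lz z d) d].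
Proof.
move=> ncr; apply: contrapT => h.
have h' (i : nat) : exists qd : 'cV[R]_m * 'cV[R]_m,
    [/\ enorm (qd.1 - zeta) < i.+1%:R^-1, D qd.1 qd.2 &
     inner (Lz qd.1 qd.2) qd.2 < i.+1%:R^-1].
  apply: contrapT => h1; apply: h; exists i.+1%:R^-1, i.+1%:R^-1.
  split; rewrite ?invr_gt0// => z d zz Dzd.
  by rewrite leNgt; apply/negP => h2; apply: h1; exists (z, d).
have [qd qdP] := choice h'.
have [U [UU Uoo]] := ultra_nat.
have qzeta e1 : 0 < e1 -> \forall j \near U, enorm ((qd j).1 - zeta) < e1.
  move=> e10; apply: filterS (invS_small _ Uoo e10) => j.
  by apply: lt_trans; case: (qdP j).
have [j|d Dd dP] := @ultra_limit_field U _ (fun i => (qd i).2) zeta UU qzeta.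
  by case: (qdP j).
have := ncr _ Dd; set I0 := inner _ _ => I0p.
(* Sum of the coefficients of [y] in [b1], [b2], [b3] and in the bound on the pairing at [q], plus
   slack. *)
pose X := C2 * M * M + 2 * C1 * M + 1 + 1.
have X0 : 0 < X.
  by rewrite /X ltr_pwDr// addr_ge0// addr_ge0// !mulr_ge0// ltW.
have [y e0 yX] : exists2 y, 0 < y & y * X = I0.
  by exists (I0 / X); [rewrite divr_gt0|rewrite divfK// gt_eqF].
have [j [[j1 j2] j3]] := filter_ex (filterI (filterI (qzeta _ e0) (dP _ e0))
   (invS_small _ Uoo e0)).
have [_ Dj Ij] := qdP j.
set q := (qd j).1 in j1 Dj Ij; set dj := (qd j).2 in j2 Dj Ij.
have E : I0 = inner (Lz q dj) dj - inner (Lz q dj - Lz zeta dj) dj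
   - inner (Lz zeta (dj - d)) dj - inner (Lz zeta d) (dj - d).
  by rewrite LzB !innerBl !innerBr /I0; ring.
have b1 : - inner (Lz q dj - Lz zeta dj) dj <= C2 * y * M * M.
  rewrite -innerNl (le_trans (inner_le _ _))// enormN.
  apply: ler_pM; rewrite ?enorm_ge0// ?(Dbd Dj)//.
  apply: (le_trans (Lz_lip _ _ _)); apply: ler_pM; rewrite ?enorm_ge0 ?(Dbd Dj)//.
    by rewrite mulr_ge0 ?enorm_ge0.
  by rewrite ler_wpM2l// ltW.
have b2 : - inner (Lz zeta (dj - d)) dj <= C1 * y * M.
  rewrite -innerNl (le_trans (inner_le _ _))// enormN.
  apply: ler_pM; rewrite ?enorm_ge0// ?(Dbd Dj)//.
  by apply: (le_trans (Lz_bd _ _)); rewrite ler_wpM2l// ltW.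
have b3 : - inner (Lz zeta d) (dj - d) <= C1 * M * y.
  rewrite -innerNl (le_trans (inner_le _ _))// enormN.
  apply: ler_pM; rewrite ?enorm_ge0// ?(ltW j2)//.
  by apply: (le_trans (Lz_bd _ _)); rewrite ler_wpM2l// (Dbd Dd).
have Ij' := lt_trans Ij j3.
have : I0 < y * X by rewrite /X; move: E b1 b2 b3 Ij' e0; lra.
by rewrite yX ltxx.
Qed.

(** The field is evaluated at [q k] instead of [z k] to allow for the inexact Newton step [w k];
    [r k] will carry the penalty term [beta *: grady g]. *)
Variables (z d q r : nat -> 'cV[R]_m) (eta : nat -> R) (B Br : R).
Hypothesis zS : forall k, z k.+1 = z k - eta k *: (Lz (z k) (d k) + r k).
Hypothesis dD : forall k, D (q k) (d k).
Hypothesis qz : forall e, 0 < e -> exists K, forall k, (K <= k)%N ->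
  enorm (q k - z k) < e.
Hypothesis r_small : forall e, 0 < e -> exists K, forall k, (K <= k)%N ->
  enorm (r k) < e.
Hypothesis rB : forall k, enorm (r k) <= Br.
Hypothesis zB : forall k, enorm (z k) <= B.
Hypothesis eta0 : forall k, 0 <= eta k.
Hypothesis eta_small : forall e, 0 < e -> exists K, forall k, (K <= k)%N ->
  eta k < e.
Hypothesis etaoo : series eta @ \oo --> +oo.

Local Notation time := (series eta).
(** Bound on the speed of the iterates with respect to [time]; the 1 makes it positive, hence a
    legitimate divisor. *)
Let V := C1 * M + Br + 1.

Let V0 : 0 < V.
Proof.
by rewrite /V ltr_pwDr// addr_ge0 ?(le_trans (enorm_ge0 _) (rB 0))// mulr_ge0// ltW.
Qed.

Lemma timeS k : time k.+1 = time k + eta k.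
Proof. by rewrite /series/= big_nat_recr. Qed.

Lemma time_le k l : (k <= l)%N -> time k <= time l.
Proof.
move=> /subnKC <-; elim: (l - k)%N => [|i IH]; first by rewrite addn0.
by rewrite addnS timeS (le_trans IH)// lerDl.
Qed.

Lemma time_ge0 k : 0 <= time k.
Proof. by have := time_le (leq0n k); rewrite /series/= big_geq. Qed.

Lemma step_bound k : enorm (z k.+1 - z k) <= V * eta k.
Proof.
rewrite zS addrAC subrr add0r enormN enormZ (ger0_norm (eta0 k)) mulrC.
rewrite ler_wpM2r// (le_trans (enormD _ _))// /V.
have := rB k; have := le_trans (Lz_bd (z k) (d k)) (ler_wpM2l C10 (Dbd (dD k))).
lra.
Qed.

Lemma move_bound k l : (k <= l)%N -> enorm (z l - z k) <= V * (time l - time k).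
Proof.
move=> /subnKC <-; elim: (l - k)%N => [|i IH].
  by rewrite addn0 !subrr enorm0 mulr0.
rewrite addnS (le_trans (enorm_triangle (z (k + i)) _ _))//.
by have := step_bound (k + i)%N; rewrite timeS; move: IH; lra.
Qed.

Lemma direction_near zeta e : 0 < e -> exists del K, 0 < del /\
  forall i, (K <= i)%N -> enorm (z i - zeta) < del ->
  exists2 d', D zeta d' & enorm (Lz (z i) (d i) + r i - Lz zeta d') <= e.
Proof.
move=> e0.
have e1 : 0 < e / (3 * (C1 + 1)) by rewrite divr_gt0// mulr_gt0// ltr_pwDr.
have [del1 del10 usc] := field_usc zeta e1.
have CM : 0 <= C2 * M by rewrite mulr_ge0// ltW.
have e2 : 0 < e / (3 * (C2 * M + 1)) by rewrite divr_gt0// mulr_gt0// ltr_pwDr.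
have [K1 K1P] := @qz (del1 / 2) ltac:(by rewrite divr_gt0).
have [K2 K2P] := @r_small (e / 3) ltac:(by rewrite divr_gt0).
exists (Num.min (del1 / 2) (e / (3 * (C2 * M + 1)))), (maxn K1 K2).
split; first by rewrite lt_min divr_gt0.
move=> i; rewrite geq_max => /andP[/K1P qi /K2P ri].
rewrite lt_min => /andP[zi1 zi2].
have [|d' Dd' dd'] := usc (q i) (d i) _ (dD i).
  by rewrite (le_lt_trans (enorm_triangle (z i) _ _))//; lra.
exists d' => //.
have -> : Lz (z i) (d i) + r i - Lz zeta d' =
    (Lz (z i) (d i) - Lz zeta (d i)) + Lz zeta (d i - d') + r i.
  by rewrite LzB addrA subrK addrAC.
rewrite (le_trans (enormD _ _))// (le_trans (lerD (enormD _ _) (lexx _)))//.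
have b1 : enorm (Lz (z i) (d i) - Lz zeta (d i)) <= e / 3.
  apply: (le_trans (Lz_lip _ _ _)).
  rewrite (le_trans (ler_wpM2l _ (Dbd (dD i))))//.
    by rewrite mulr_ge0 ?enorm_ge0.
  move: zi2; rewrite ltr_pdivlMr ?mulr_gt0 ?ltr_pwDr// => zi2.
  by have := enorm_ge0 (z i - zeta); lra.
have b2 : enorm (Lz zeta (d i - d')) <= e / 3.
  apply: (le_trans (Lz_bd _ _)).
  move: dd'; rewrite ltr_pdivlMr ?mulr_gt0 ?ltr_pwDr// => dd'.
  by have := enorm_ge0 (d i - d'); lra.
lra.
Qed.

(* Convexity of [D zeta]: a weighted mean of directions is again a direction at [zeta], up to [e]. *)
Lemma average_direction zeta e a k :
  (forall i, (a <= i < a + k)%N -> exists2 d', D zeta d' &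
     enorm (Lz (z i) (d i) + r i - Lz zeta d') <= e) ->
  exists2 d', D zeta d' &
    enorm (z a - z (a + k)%N - (time (a + k)%N - time a) *: Lz zeta d')
    <= e * (time (a + k)%N - time a).
Proof.
elim: k => [|k IH] h.
  have [d' Dd'] := Dne zeta; exists d' => //.
  by rewrite addn0 !subrr scale0r subr0 enorm0 mulr0.
have [|d1 Dd1 h1] := IH.
  move=> i /andP[ai ik]; apply: h; rewrite ai addnS ltnS ltnW//.
have [|d2 Dd2 h2] := h (a + k)%N; first by rewrite leq_addr addnS ltnS leqnn.
set S := time (a + k)%N - time a in h1 *.
have S0 : 0 <= S by rewrite subr_ge0 time_le// leq_addr.
rewrite addnS timeS zS; set et := eta (a + k)%N; set v := Lz _ _ + r _ in h2 *.
have et0 : 0 <= et by exact: eta0.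
rewrite (_ : time (a + k)%N + et - time a = S + et); last by rewrite /S; ring.
have [d' Dd' E] : exists2 d', D zeta d' &
    (S + et) *: Lz zeta d' = S *: Lz zeta d1 + et *: Lz zeta d2.
  (* Steps may have length 0; if the total weight vanishes, any element of [D zeta] will do. *)
  have [Se0|Se0] := eqVneq (S + et) 0.
    move/eqP: Se0; rewrite paddr_eq0// => /andP[/eqP -> /eqP ->].
    by exists d1; rewrite // addr0 !scale0r addr0.
  have Sep : 0 < S + et by rewrite lt_neqAle eq_sym Se0 addr_ge0.
  exists (S / (S + et) *: d1 + (1 - S / (S + et)) *: d2).
    apply: Dconv => //; first by rewrite divr_ge0// ltW.
    by rewrite ler_pdivrMr// mul1r lerDl.
  rewrite LzD scalerDr !scalerA mulrBr mulr1 mulrC divfK//.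
  by rewrite [S + et]addrC addrK.
exists d' => //; rewrite E.
have -> : z a - (z (a + k)%N - et *: v) - (S *: Lz zeta d1 + et *: Lz zeta d2) =
  (z a - z (a + k)%N - S *: Lz zeta d1) + et *: (v - Lz zeta d2).
  rewrite scalerBr [RHS]addrACA -opprD; congr (_ - _).
  by rewrite opprB addrA addrAC.
rewrite (le_trans (enormD _ _))// mulrDr lerD// enormZ (ger0_norm et0) mulrC.
by rewrite ler_wpM2r.
Qed.

(** Because of zero steps several indices may share one time; the strict upper inequality selects
    the last of them. *)
Lemma time_index : exists N : R -> nat,
  forall s, 0 <= s -> time (N s) <= s < time (N s).+1.
Proof.
suff h (s : R) : exists i, 0 <= s -> time i <= s < time i.+1.
  by have [N NP] := choice h; exists N.
have [s0|s0] := ltP s 0; first by exists 0%N.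
have [K _ KP] := (cvgryPgt _).1 etaoo s.
have ex : exists i, s < time i.+1 by exists K; exact: (KP K.+1 (leqnSn K)).
exists (ex_minn ex) => _; case: ex_minnP => i -> imin; rewrite andbT.
case: i imin => [_|i imin]; first by rewrite /series/= big_geq.
by rewrite leNgt; apply/negP => /imin; rewrite ltnn.
Qed.

(** * Limit curves of rescaled trajectory pieces *)

Section Limit_curve.
Variable N : R -> nat.
Hypothesis NP : forall s, 0 <= s -> time (N s) <= s < time (N s).+1.
Variable phi : nat -> nat.
Hypothesis phi_ge : forall j, (j <= phi j)%N.
Variable U : set_system nat.
Hypothesis UU : UltraFilter U.
Hypothesis Uoo : forall K, \forall j \near U, (K <= j)%N.
Variables (T : R) (T0 : 0 < T).

(* Time runs backwards, so that the integrand of the potential is bounded below. *)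
Definition clock j t := time (phi j) + T * `|1 - t|.
Variable gam : R -> 'cV[R]_m.
Hypothesis gamP : forall t e, 0 < e ->
  \forall j \near U, enorm (z (N (clock j t)) - gam t) < e.

Lemma index_ge k s : time k <= s -> (k <= N s)%N.
Proof.
move=> ks; have s0 := le_trans (time_ge0 k) ks.
rewrite leqNgt; apply/negP => /time_le h; have /andP[_] := NP s0.
by rewrite ltNge (le_trans h ks).
Qed.

Lemma index_le s s' : 0 <= s -> s <= s' -> (N s <= N s')%N.
Proof.
by move=> s0 ss'; apply: index_ge; have /andP[h _] := NP s0; exact: le_trans h ss'.
Qed.

Lemma clock_ge j t : time (phi j) <= clock j t.
Proof. by rewrite /clock lerDl mulr_ge0// ltW. Qed.

Lemma clock_ge0 j t : 0 <= clock j t.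
Proof. exact: le_trans (time_ge0 _) (clock_ge j t). Qed.

Lemma near_eta e : 0 < e ->
  \forall j \near U, forall k, (phi j <= k)%N -> eta k < e.
Proof.
move=> e0; have [K KP] := eta_small e0.
apply: filterS (Uoo K) => j Kj k jk; apply: KP.
exact: leq_trans Kj (leq_trans (phi_ge j) jk).
Qed.

Lemma elapsed s s' : 0 <= s -> s <= s' ->
  s' - s - eta (N s') <= time (N s') - time (N s) <= s' - s + eta (N s).
Proof.
move=> s0 ss'; have /andP[a1] := NP s0; rewrite timeS => a2.
have /andP[b1] := NP (le_trans s0 ss'); rewrite timeS => b2.
apply/andP; lra.
Qed.

(** The approximating step curves jump, but by amounts that vanish along [U]. The absolute value in
    [clock] reflects the curve at 1, so that the bound holds on the whole line, as
    [lipschitz_ae_derivable] requires. *)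
Lemma gam_lip s t : enorm (gam s - gam t) <= V * T * `|s - t|.
Proof.
wlog st : s t / `|1 - s| <= `|1 - t| => [wl|].
  have [/wl//|/ltW/wl] := leP `|1 - s| `|1 - t|.
  by rewrite enormC distrC.
apply/ler_addgt0Pr => e e0.
pose e1 := e / (3 + V).
have V3 : 0 < 3 + V by rewrite addr_gt0.
have e10 : 0 < e1 by rewrite divr_gt0.
have [j [[js jt] je]] := filter_ex (filterI (filterI (gamP s e10) (gamP t e10))
  (near_eta e10)).
have cst : clock j s <= clock j t by rewrite /clock lerD2l ler_pM2l.
have := move_bound (index_le (clock_ge0 j s) cst).
have /andP[_ el] := elapsed (clock_ge0 j s) cst.
have := je _ (index_ge (clock_ge j s)) => eN.
have dst : clock j t - clock j s <= T * `|s - t|.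
  rewrite /clock opprD addrACA subrr add0r -mulrBr ler_pM2l//.
  rewrite (le_trans (ler_norm _))// (le_trans (ler_dist_dist _ _))//.
  by rewrite opprB addrC subrKA.
move=> mb.
have mb' : enorm (z (N (clock j t)) - z (N (clock j s))) <= V * (T * `|s - t| + e1).
  by rewrite (le_trans mb)// ler_pM2l//; lra.
rewrite enormC in js.
rewrite (le_trans (enorm_triangle (z (N (clock j s))) _ _))//.
have := enorm_triangle (z (N (clock j t))) (z (N (clock j s))) (gam t).
rewrite (enormC (z (N (clock j s))) (z (N (clock j t)))).
have : e1 * (3 + V) = e by rewrite /e1 divfK// gt_eqF.
move: mb' js jt; lra.
Qed.

Lemma gam_abs_cont : abs_cont01 gam.
Proof.
move=> e e0.
have VT : 0 < V * T by rewrite mulr_gt0.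
exists (e / (V * T)) => [|k a b ab _ h]; first by rewrite divr_gt0.
apply: (@le_lt_trans _ _ (\sum_(i < k) V * T * (b i - a i))).
  apply: ler_sum => i _; apply: (le_trans (gam_lip _ _)).
  by have [_ [abi _]] := ab i; rewrite ger0_norm// subr_ge0.
by rewrite -mulr_sumr mulrC -ltr_pdivlMr.
Qed.

(** The difference quotient between [t - s] and [t] is compared with the mean direction of the
    iterates in between, which [average_direction] places near [Lz (gam t) d']. *)
Lemma gam_derive t e : t < 1 -> 0 < e -> derivable gam t 1 ->
  exists2 d', D (gam t) d' & enorm ('D_1 gam t - T *: Lz (gam t) d') <= e.
Proof.
move=> t1 e0 dgam; set zeta := gam t.
(* One share for the difference quotient, two for the end points, one for elapsed time against
   [T * s], and [2 * T] for the mean direction. *)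
pose e1 := e / (4 + 2 * T).
have T4 : 0 < 4 + 2 * T by rewrite addr_gt0// mulr_gt0.
have e10 : 0 < e1 by rewrite divr_gt0.
have [del [K [del0 near_dir]]] := direction_near zeta e10.
have /cvg_enormP/(_ e1 e10) : h^-1 *: ((gam \o shift t) (h *: 1) - gam t)
  @[h --> 0^'] --> 'D_1 gam t by exact: dgam.
move=> [/= rho rho0 rhoP].
(* The first bound brings the quotient close to the derivative; the second keeps the iterates of the
   piece within [del] of [zeta]. *)
pose s := Num.min (rho / 2) (del / (8 * (V * T))).
have VT : 0 < V * T by rewrite mulr_gt0.
have s0 : 0 < s by rewrite lt_min !divr_gt0// mulr_gt0.
have sdel : V * T * s <= del / 8.
  have : s <= del / (8 * (V * T)) by rewrite ge_min lexx orbT.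
  rewrite ler_pdivlMr ?mulr_gt0//; lra.
have srho : s < rho.
  have : s <= rho / 2 by rewrite ge_min lexx.
  lra.
have CM : 0 <= C1 * M by rewrite mulr_ge0// ltW.
(* Bound on the step sizes, chosen after [s]: the error in elapsed time must remain small after
   division by [s]. *)
pose e2 := Num.min (e1 * s / (C1 * M + 1)) (T * s).
have CM1 : 0 < C1 * M + 1 by rewrite ltr_pwDr.
have e20 : 0 < e2.
  rewrite lt_min; apply/andP; split; last exact: mulr_gt0.
  by apply: divr_gt0 => //; exact: mulr_gt0.
have e2T : e2 <= T * s by rewrite ge_min lexx orbT.
have e2C : e2 * (C1 * M + 1) <= e1 * s.
  by rewrite -ler_pdivlMr// ge_min lexx.
have es0 : 0 < e1 * s by rewrite mulr_gt0.
have del2 : 0 < del / 2 by rewrite divr_gt0.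
have [j [[[[jt jt'] js] je] jK]] := filter_ex (filterI (filterI (filterI (filterI
  (gamP t es0) (gamP t del2)) (gamP (t - s) es0)) (near_eta e20)) (Uoo K)).
have clk : clock j (t - s) = clock j t + T * s.
  rewrite /clock opprB addrCA -addrA mulrC.
  rewrite (ger0_norm (_ : 0 <= 1 - t)) ?subr_ge0 ?(ltW t1)//.
  rewrite ger0_norm; first by ring.
  by rewrite addr_ge0 ?(ltW s0)// subr_ge0 ltW.
have cst : clock j t <= clock j (t - s) by rewrite clk lerDl mulr_ge0 ?ltW.
set a := N (clock j t) in jt jt'; set b := N (clock j (t - s)) in js.
have ab : (a <= b)%N by exact: index_le (clock_ge0 j t) cst.
have pa : (phi j <= a)%N by exact: index_ge (clock_ge j t).
have /andP[] := elapsed (clock_ge0 j t) cst.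
rewrite -/a -/b; set S := time b - time a.
have -> : clock j (t - s) - clock j t = T * s by rewrite clk addrAC subrr add0r.
move=> S1 S2.
have ea := je _ pa; have eb := je _ (leq_trans pa ab).
have [|d' Dd'] := @average_direction zeta e1 a (b - a)%N.
  move=> i; rewrite subnKC// => /andP[ai ib]; apply: near_dir.
    exact: leq_trans jK (leq_trans (phi_ge j) (leq_trans pa ai)).
  rewrite (le_lt_trans (enorm_triangle (z a) _ _))//.
  have h1 := move_bound ai.
  have h2 : V * (time i - time a) <= V * (2 * (T * s)).
    rewrite ler_pM2l//; have := time_le (ltnW ib).
    by move: S2; rewrite /S; lra.
  lra.
rewrite subnKC// -/S => avg; exists d' => //.
have /= := rhoP (- s); rewrite sub0r opprK gtr0_norm// => /(_ srho).
rewrite oppr_eq0 (gt_eqF s0) => /(_ isT).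
rewrite [- s *: 1]mulr1 (addrC (- s)) -/zeta => hder.
have L1 : enorm (Lz zeta d') <= C1 * M.
  by apply: (le_trans (Lz_bd _ _)); rewrite ler_wpM2l// (Dbd Dd').
have key : enorm (zeta - gam (t - s) - (s * T) *: Lz zeta d') <= e1 * (3 + 2 * T) * s.
  have -> : zeta - gam (t - s) - (s * T) *: Lz zeta d' =
     - (z a - zeta) + (z b - gam (t - s)) + (z a - z b - S *: Lz zeta d') +
     (S - s * T) *: Lz zeta d'.
    by apply/colP => i; rewrite !mxE; ring.
  rewrite (le_trans (enormD _ _))//.
  rewrite (le_trans (lerD (enormD _ _) (lexx _)))//.
  rewrite (le_trans (lerD (lerD (enormD _ _) (lexx _)) (lexx _)))//.
  have bS : enorm ((S - s * T) *: Lz zeta d') <= e2 * (C1 * M).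
    rewrite enormZ; apply: ler_pM; rewrite ?enorm_ge0//.
    by rewrite ler_norml; apply/andP; move: S1 S2 ea eb; lra.
  have : e1 * S <= e1 * (2 * (T * s)) by rewrite ler_pM2l//; move: S2 ea e2T; lra.
  rewrite enormN; move: jt js avg bS e2C e20; lra.
have sn0 : s != 0 by rewrite gt_eqF.
have key2 : enorm (s^-1 *: (zeta - gam (t - s)) - T *: Lz zeta d') <= e1 * (3 + 2 * T).
  have -> : s^-1 *: (zeta - gam (t - s)) - T *: Lz zeta d' =
    s^-1 *: (zeta - gam (t - s) - (s * T) *: Lz zeta d').
    by rewrite [RHS]scalerBr scalerA mulrA mulVf// mul1r.
  by rewrite enormZ ger0_norm ?invr_ge0 ?(ltW s0)// mulrC ler_pdivrMr.
rewrite (le_trans (enorm_triangle (s^-1 *: (zeta - gam (t - s))) _ _))//.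
move: hder; rewrite invrN scaleNr -scalerN opprB enormC => hder.
have : e1 * (4 + 2 * T) = e by rewrite /e1 divfK// gt_eqF.
move: hder key2; lra.
Qed.

Lemma field_integrand_ge t c : t < 1 -> derivable gam t 1 ->
  (forall d', D (gam t) d' -> c <= inner (Lz (gam t) d') d') ->
  T * c <= field_integrand D gam t.
Proof.
move=> t1 dgam cP; apply/ler_addgt0Pr => e e0.
have eM : 0 < e / M by rewrite divr_gt0.
have [d' Dd' hd'] := gam_derive t1 eM dgam.
apply: (@le_trans _ _ (inner ('D_1 gam t) d' + e)); last first.
  rewrite lerD2r; apply: ub_le_sup; last by exists d'.
  exists (enorm ('D_1 gam t) * M) => _ [v Dv <-].
  by rewrite (le_trans (inner_le _ _))// ler_wpM2l ?enorm_ge0// (Dbd Dv).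
have h : - inner ('D_1 gam t - T *: Lz (gam t) d') d' <= e.
  rewrite -innerNl (le_trans (inner_le _ _))// enormN.
  rewrite -(divfK (_ : M != 0) e) ?gt_eqF//.
  by apply: ler_pM; rewrite ?enorm_ge0// (Dbd Dd').
have Tc : T * c <= T * inner (Lz (gam t) d') d' by rewrite ler_pM2l// cP.
by move: h Tc; rewrite innerBl innerZl; lra.
Qed.

Hypothesis Fpot : is_potential F D.

(** [V * T < rho] keeps the whole curve in the ball around [gam 1] where the gap holds, and
    differentiability almost everywhere is obtained coordinate by coordinate. *)
Lemma potential_drop c rho : 0 < c -> V * T < rho ->
  (forall z d, enorm (z - gam 1) < rho -> D z d -> c <= inner (Lz z d) d) ->
  T * c <= F (gam 1) - F (gam 0).
Proof.
move=> c0 VTr gap.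
have dgam : {ae (@lebesgue_measure R), forall t, 0 < t < 1 -> derivable gam t 1}.
  have coord i : {ae (@lebesgue_measure R), forall t, 0 < t < 1 ->
      derivable (fun s => gam s i ord0) t 1}.
    apply: (@lipschitz_ae_derivable _ _ (V * T)) => // s t.
    apply: le_trans (gam_lip s t); apply: le_trans (coord_le_enorm _ i).
    by rewrite !mxE.
  have : {ae (@lebesgue_measure R), forall t, forall i, 0 < t < 1 ->
      derivable (fun s => gam s i ord0) t 1}.
    apply: filter_forall => //; exact: (ae_filter_ringOfSetsType (@lebesgue_measure R)).
  apply: filterS; first exact: (ae_filter_ringOfSetsType (@lebesgue_measure R)).
  move=> t h t01; apply/derivable_mxP => i k; rewrite ord1; exact: h.
rewrite -lee_fin -(Fpot gam_abs_cont); apply: integral01_ge.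
  by rewrite mulr_ge0// ltW.
move: dgam; apply: filterS; first exact: (ae_filter_ringOfSetsType (@lebesgue_measure R)).
move=> t h /[dup] /andP[t0 t1] /h {}h.
apply: field_integrand_ge => // d' Dd'; apply: gap => //.
rewrite (le_lt_trans (gam_lip _ _))// (le_lt_trans _ VTr)//.
have dist1 : `|t - 1| <= 1.
  have t10 : 0 <= 1 - t by rewrite subr_ge0 ltW.
  by rewrite distrC (ger0_norm t10) gerBl ltW.
by apply: ler_piMr => //; rewrite mulr_ge0// ltW.
Qed.

End Limit_curve.


(** * Descent near noncritical points and convergence of the values *)

Hypothesis Fpot : is_potential F D.
Hypothesis FM : forall a b, `|F a - F b| <= M * enorm (a - b).
Hypothesis Lz_ge0 : forall z d, 0 <= inner (Lz z d) d.

(** For [flow_dir] the pairing is the squared norm of the reduced gradient. *)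
Definition critical zeta := exists2 d, D zeta d & inner (Lz zeta d) d = 0.

Lemma descent_near (U : set_system nat) (phi : nat -> nat) zeta Tm :
  UltraFilter U -> (forall K, \forall j \near U, (K <= j)%N) ->
  (forall j, (j <= phi j)%N) ->
  (forall e, 0 < e -> \forall j \near U, enorm (z (phi j) - zeta) < e) ->
  ~ critical zeta -> 0 < Tm ->
  exists2 e, 0 < e & \forall j \near U, exists k,
    [/\ (phi j <= k)%N, time k - time (phi j) <= Tm & F (z k) <= F zeta - e].
Proof.
move=> UU Uoo phi_ge phiz ncr Tm0.
have [|c [rho [c0 rho0 gap]]] := @noncritical_gap zeta.
  move=> d' Dd'; rewrite lt_neqAle Lz_ge0 andbT; apply/eqP => h.
  by apply: ncr; exists d'.
pose T := Num.min Tm (rho / (2 * V)).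
have T0 : 0 < T by rewrite lt_min Tm0 divr_gt0// mulr_gt0.
have VT : V * T < rho.
  have : T <= rho / (2 * V) by rewrite ge_min lexx orbT.
  rewrite ler_pdivlMr ?mulr_gt0//; move: rho0; lra.
have [N NP] := time_index.
have gamE t : exists l, forall e, 0 < e -> \forall j \near U,
    enorm (z (N (clock phi T j t)) - l) < e.
  by apply: ultra_cvg_bounded => j; exact: zB.
have [gam gamP] := choice gamE.
have gam1 : gam 1 = zeta.
  apply/eqP; rewrite -subr_eq0; apply/eqP/enorm_eq0/eqP.
  rewrite eq_le enorm_ge0 andbT; apply/ler_addgt0Pr => e e0; rewrite add0r.
  have e2 : 0 < e / 2 by rewrite divr_gt0.
  have [j [j1 j2]] := filter_ex (filterI (gamP 1 _ e2) (phiz _ e2)).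
  have cE : clock phi T j 1 = time (phi j).
    by rewrite /clock subrr normr0 mulr0 addr0.
  rewrite cE in j1.
  (* Zero steps can push [N (time (phi j))] beyond [phi j], but the iterate does not move while no
     time elapses. *)
  have := move_bound (index_ge NP (lexx (time (phi j)))).
  have /andP[h _] := NP _ (time_ge0 (phi j)).
  have h' : V * (time (N (time (phi j))) - time (phi j)) <= 0.
    by rewrite pmulr_rle0// subr_le0.
  move=> /le_trans/(_ h') h2.
  rewrite (le_trans (enorm_triangle (z (N (time (phi j)))) _ _))//.
  have := enorm_triangle (z (phi j)) (z (N (time (phi j)))) zeta.
  rewrite (enormC (gam 1)); move: j1 j2 h2; lra.
have drop : T * c <= F zeta - F (gam 0).
  rewrite -gam1; apply: (@potential_drop N NP phi phi_ge U UU Uoo T T0 gam) => //.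
  - exact: VT.
  - by rewrite gam1.
have Tc : 0 < T * c by rewrite mulr_gt0.
(* The other half of the drop pays for replacing [gam 0] by an iterate. *)
exists (T * c / 2); first by rewrite divr_gt0.
have e1 : 0 < T * c / 2 / M by rewrite !divr_gt0.
apply: filterS (gamP 0 _ e1) => j hj.
exists (N (clock phi T j 0)); split.
- exact: (index_ge NP (clock_ge phi T0 j 0)).
- have /andP[h _] := NP _ (clock_ge0 phi T0 j 0).
  have TTm : T <= Tm by rewrite ge_min lexx.
  by move: h; rewrite {2}/clock subr0 normr1 mulr1; move: TTm; lra.
- have := ler_norm (F (z (N (clock phi T j 0))) - F (gam 0)).
  move=> /le_trans/(_ (FM _ _)) h.
  move: hj; rewrite ltr_pdivlMr// => hj; move: drop h hj; lra.
Qed.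

Definition cluster_value zeta := forall e (J : nat), 0 < e ->
  exists2 k, (J <= k)%N & enorm (z k - zeta) < e.

(** The value [a] at one cluster point is approached infinitely often. Without convergence the
    values are also infinitely often at distance [e] from [a], above or below it, and two thresholds
    fit in between. *)
Lemma oscillation : ~ (exists l, forall e, 0 < e ->
    exists K, forall k, (K <= k)%N -> `|F (z k) - l| < e) ->
  exists r1 r2, [/\ r1 < r2, forall K, exists2 k, (K <= k)%N & F (z k) < r1 &
    forall K, exists2 k, (K <= k)%N & r2 < F (z k)].
Proof.
move=> nl.
have [U [UU Uoo]] := ultra_nat.
have [zeta zetaP] := ultra_cvg_bounded UU zB.
pose a := F zeta.
have near_a e (K : nat) : 0 < e -> exists2 k, (K <= k)%N & `|F (z k) - a| < e.
  move=> e0; have e1 : 0 < e / M by rewrite divr_gt0.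
  have [k [k1 k2]] := filter_ex (filterI (zetaP _ e1) (Uoo K)).
  exists k => //; rewrite (le_lt_trans (FM _ _))// mulrC -ltr_pdivlMr//.
have [e e0 far] : exists2 e, 0 < e &
    forall K, exists2 k, (K <= k)%N & e <= `|F (z k) - a|.
  apply: contrapT => h; apply: nl; exists a => e e0.
  apply: contrapT => h1; apply: h; exists e => // K.
  apply: contrapT => h2; apply: h1; exists K => k Kk.
  by rewrite ltNge; apply/negP => h3; apply: h2; exists k.
have e3 : 0 < e / 3 by rewrite divr_gt0.
have [up|nup] := pselect (forall K, exists2 k, (K <= k)%N & a + e <= F (z k)).
  exists (a + e / 3), (a + e / 2); split; first lra.
    move=> K; have [k Kk] := near_a _ K e3; rewrite ltr_norml => /andP[_ h].
    by exists k => //; lra.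
  by move=> K; have [k Kk h] := up K; exists k => //; lra.
exists (a - e / 2), (a - e / 3); split; first lra.
  have [K0 K0P] : exists K0, forall k, (K0 <= k)%N -> F (z k) < a + e.
    apply: contrapT => h; apply: nup => K; apply: contrapT => h1; apply: h.
    exists K => k Kk; rewrite ltNge; apply/negP => h2; apply: h1; by exists k.
  move=> K; have [k] := far (maxn K K0); rewrite geq_max => /andP[Kk /K0P h1].
  move=> h2; exists k => //; move: h2; rewrite ler_normr => /orP[]; lra.
move=> K; have [k Kk] := near_a _ K e3; rewrite ltr_norml => /andP[h _].
by exists k => //; lra.
Qed.

(** Some level [lev] between the two thresholds avoids [S]. Upcrossings of [lev] start near a point
    [zeta] with [F zeta = lev], hence noncritical, and descent from there falls below [lev] before
    [r2] can be reached. *)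
Lemma values_converge (S : set R) : interior S = set0 ->
  (forall zeta, cluster_value zeta -> critical zeta -> S (F zeta)) ->
  exists l, forall e, 0 < e ->
    exists K, forall k, (K <= k)%N -> `|F (z k) - l| < e.
Proof.
move=> S0 critS; apply: contrapT => /oscillation[r1 [r2 [r12 below above]]].
have [lev [r1r rr2] Sr] : exists2 lev, r1 < lev /\ lev < r2 & ~ S lev.
  apply: contrapT => h.
  suff : interior S ((r1 + r2) / 2) by rewrite S0.
  apply/nbhs_ballP; exists ((r2 - r1) / 2) => /=; first by move: r12; lra.
  move=> y /=; rewrite /ball/= ltr_norml => /andP[y1 y2].
  apply: contrapT => Sy; apply: h; exists y => //; lra.
have cross (J : nat) : exists kl : nat * nat,
    [/\ (J <= kl.1)%N, (kl.1 < kl.2)%N, F (z kl.1) <= lev, r2 < F (z kl.2) &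
     forall i, (kl.1 < i <= kl.2)%N -> lev < F (z i)].
  have [k0 Jk0 k0r] := below J; have [l k0l lr] := above k0.
  (* The crossing starts at the last index before [l] whose value is at most [lev]. *)
  pose P i := (i <= l)%N && (F (z i) <= lev) && (k0 <= i)%N.
  have exP : exists i, P i.
    by exists k0; rewrite /P k0l leqnn andbT; move: k0r r1r; lra.
  have Pb i : P i -> (i <= l)%N by move=> /andP[/andP[]].
  case: (ex_maxnP exP Pb) => k /andP[/andP[kl kr] k0k] kmax.
  exists (k, l); split => //=.
  - exact: leq_trans Jk0 k0k.
  - rewrite ltn_neqAle kl andbT; apply/eqP => kl'; move: lr kr rr2.
    by rewrite kl'; lra.
  - move=> i /andP[ki il]; rewrite ltNge; apply/negP => ir.
    have : P i by rewrite /P il ir (leq_trans k0k (ltnW ki)).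
    by move=> /kmax; rewrite leqNgt ki.
have [kl klP] := choice cross.
pose phi j := (kl j).1.
have phi_ge j : (j <= phi j)%N by case: (klP j).
have [U [UU Uoo]] := ultra_nat.
have [zeta zetaP] := ultra_cvg_bounded UU (fun j => zB (phi j)).
have cl : cluster_value zeta.
  move=> e J e0; have [j [j1 j2]] := filter_ex (filterI (zetaP _ e0) (Uoo J)).
  by exists (phi j) => //; exact: leq_trans j2 (phi_ge j).
have MV0 : 0 < M * V by rewrite mulr_gt0.
have step k : `|F (z k.+1) - F (z k)| <= M * V * eta k.
  by rewrite (le_trans (FM _ _))// -mulrA ler_pM2l// step_bound.
(* One step later the value exceeds [lev], and small steps change [F] little. *)
have near_r e : 0 < e -> \forall j \near U, lev - e < F (z (phi j)).
  move=> e0; have e1 : 0 < e / (M * V) by rewrite divr_gt0.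
  apply: filterS (near_eta phi_ge UU Uoo e1) => j /(_ _ (leqnn _)).
  rewrite ltr_pdivlMr// => h.
  have [_ k1 k2 k3 k4] := klP j.
  have := k4 (phi j).+1; rewrite ltnSn k1 => /(_ isT).
  have := le_trans (ler_norm _) (step (phi j)); rewrite -/(phi j); move: h; lra.
have Fr : F zeta = lev.
  apply/eqP; rewrite eq_le; apply/andP; split; apply/ler_addgt0Pr => e e0;
    have e1 : 0 < e / 2 / M by rewrite !divr_gt0.
    have [j j1] := filter_ex (zetaP _ e1); have [_ _ k2 _ _] := klP j.
    have := le_trans (ler_norm _) (FM zeta (z (phi j))).
    move: j1; rewrite enormC ltr_pdivlMr//; move: k2; rewrite -/(phi j); lra.
  have e2 : 0 < e / 2 by rewrite divr_gt0.
  have [j [j1 j2]] := filter_ex (filterI (zetaP _ e1) (near_r _ e2)).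
  have := le_trans (ler_norm _) (FM (z (phi j)) zeta).
  by move: j1; rewrite ltr_pdivlMr//; move: j2; lra.
have ncr : ~ critical zeta by move=> /(critS _ cl); rewrite Fr.
(* [F] changes at rate at most [M * V], so climbing from [lev] to [r2] takes at least this time. *)
have Tm0 : 0 < (r2 - lev) / (M * V) by rewrite divr_gt0// subr_gt0.
have [e e0 desc] := descent_near UU Uoo phi_ge zetaP ncr Tm0.
have [j [[k [jk kT Fk]] jr]] := filter_ex (filterI desc (near_r _ e0)).
rewrite Fr in Fk.
have [_ k1 k2 k3 k4] := klP j; rewrite -/(phi j) in k1 k2 k4.
have [kl'|lk] := leqP k (kl j).2.
  move: jk; rewrite leq_eqVlt => /predU1P[jk|jk]; first by move: jr; rewrite jk; lra.
  by have := k4 k; rewrite jk kl' => /(_ isT); move: Fk e0; lra.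
have h1 := le_trans (ler_norm _) (FM (z (kl j).2) (z (phi j))).
have h2 := move_bound (ltnW k1).
have h3 : time (kl j).2 - time (phi j) <= (r2 - lev) / (M * V).
  by have := time_le (ltnW lk); move: kT; lra.
have h4 : M * enorm (z (kl j).2 - z (phi j)) <= r2 - lev.
  move: h3; rewrite ler_pdivlMr// => h3.
  apply: le_trans h3; rewrite [leRHS]mulrC -mulrA ler_pM2l//.
by move: h1 h4 k2 k3; lra.
Qed.

Lemma limit_critical l (phi : nat -> nat) zeta :
  (forall e, 0 < e -> exists K, forall k, (K <= k)%N -> `|F (z k) - l| < e) ->
  (forall j, (j <= phi j)%N) ->
  (forall e, 0 < e -> exists J, forall j, (J <= j)%N -> enorm (z (phi j) - zeta) < e) ->
  critical zeta.
Proof.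
move=> Fl phi_ge phiz; apply: contrapT => ncr.
have [U [UU Uoo]] := ultra_nat.
have zetaP e : 0 < e -> \forall j \near U, enorm (z (phi j) - zeta) < e.
  by move=> /phiz[J JP]; apply: filterS (Uoo J) => j /JP.
have [e e0 desc] := descent_near UU Uoo phi_ge zetaP ncr ltr01.
have e4 : 0 < e / 4 by rewrite divr_gt0.
have e4M : 0 < e / 4 / M by rewrite divr_gt0.
have [K KP] := Fl _ e4.
have [j [[[k [jk _ Fk]] jz] jK]] :=
  filter_ex (filterI (filterI desc (zetaP _ e4M)) (Uoo K)).
have Kj : (K <= phi j)%N by exact: leq_trans jK (phi_ge j).
have := KP _ Kj; have := KP _ (leq_trans Kj jk).
rewrite !ltr_norml => /andP[a1 a2] /andP[b1 b2].
have := le_trans (ler_norm _) (FM zeta (z (phi j))).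
by move: jz; rewrite enormC ltr_pdivlMr//; move: Fk a1 b2; lra.
Qed.

End Inclusion.

(** * A perturbed contraction *)

(** Once the steps are small, above the level [e / 2] the sequence loses a fixed multiple of [eta k]
    per step, and these sum to infinity; at or below that level it is trapped, as the quadratic
    error is only half of the contraction. *)
Lemma contraction_cvg0 (R : realType) (a eta : nat -> R) (c C : R) (K0 : nat) :
  0 < c -> 0 <= C -> (forall k, 0 <= eta k) -> (forall k, 0 <= a k) ->
  (forall e, 0 < e -> exists K, forall k, (K <= k)%N -> eta k < e) ->
  series eta @ \oo --> +oo ->
  (forall k, (K0 <= k)%N -> a k.+1 <= (1 - c * eta k) * a k + C * eta k ^+ 2) ->
  forall e, 0 < e -> exists K, forall k, (K <= k)%N -> a k < e.
Proof.
move=> c0 C0 eta0 a0 eta_small etaoo rec e e0.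
pose e' := e / 2; have e'0 : 0 < e' by rewrite divr_gt0.
have ce : 0 < c * e' / 2 by rewrite divr_gt0// mulr_gt0.
have [K1 K1P] : exists K, forall k, (K <= k)%N -> eta k < c * e' / 2 / (C + 1).
  by apply: eta_small; rewrite divr_gt0// ltr_pwDr.
have [K2 K2P] : exists K, forall k, (K <= k)%N -> eta k < c^-1.
  by apply: eta_small; rewrite invr_gt0.
pose K := maxn K0 (maxn K1 K2).
have KP k : (K <= k)%N -> [/\ a k.+1 <= (1 - c * eta k) * a k + C * eta k ^+ 2,
    C * eta k <= c * e' / 2 & c * eta k <= 1].
  rewrite !geq_max => /andP[h0 /andP[/K1P h1 /K2P h2]]; split; first exact: rec.
    move: h1; rewrite ltr_pdivlMr ?ltr_pwDr//; have := eta0 k; lra.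
  by move: h2; rewrite -[c^-1]mul1r ltr_pdivlMr// mulrC => /ltW.
have bnd k : (K <= k)%N -> a k.+1 <= (1 - c * eta k) * a k + eta k * (c * e' / 2).
  move=> /KP[h1 h2 _]; apply: (le_trans h1); rewrite lerD2l.
  by rewrite expr2 mulrA mulrC ler_wpM2l.
have [k Kk ak] : exists2 k, (K <= k)%N & a k <= e'.
  apply: contrapT => h.
  have big k : (K <= k)%N -> e' < a k.
    by move=> Kk; rewrite ltNge; apply/negP => ak; apply: h; exists k.
  have dec i : a (K + i)%N <= a K - c * e' / 2 * (series eta (K + i)%N - series eta K).
    elim: i => [|i IH]; first by rewrite addn0 subrr mulr0 subr0.
    rewrite addnS timeS.
    have Ki := leq_addr i K.
    have := bnd _ Ki; have := big _ Ki => h1.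
    have h2 : c * eta (K + i)%N * e' <= c * eta (K + i)%N * a (K + i)%N.
      by rewrite ler_wpM2l ?(ltW h1)// mulr_ge0// ltW.
    by move: IH h2; lra.
  have [L _ LP] := (cvgryPgt _).1 etaoo (series eta K + a K / (c * e' / 2)).
  have := LP (K + L)%N (leq_addl _ _) => /=.
  rewrite -ltrBrDl ltr_pdivrMr// => h1.
  by have := dec L; have := a0 (K + L)%N; have := big _ (leq_addr L K); lra.
exists k => i /subnKC <-.
suff : a (k + (i - k))%N <= e' by rewrite /e'; lra.
elim: (i - k)%N => [|l IH]; first by rewrite addn0.
rewrite addnS; have Kl := leq_trans Kk (leq_addr l k).
have [_ _ h] := KP _ Kl.
apply: (le_trans (bnd _ Kl)).
have : (1 - c * eta (k + l)%N) * a (k + l)%N <= (1 - c * eta (k + l)%N) * e'.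
  by rewrite ler_wpM2l// subr_ge0.
by have := mulr_ge0 (mulr_ge0 (ltW c0) (eta0 (k + l)%N)) (ltW e'0); lra.
Qed.

(** * Coercive matrices and matrix identities *)

Section Coercive.
Variables (R : realType) (p : nat) (mu : R) (A : 'M[R]_p).
Hypothesis mu0 : 0 < mu.
Hypothesis Amu : forall v, mu * enorm v ^+ 2 <= inner v (A *m v).

Lemma coercive_lower v : mu * enorm v <= enorm (A *m v).
Proof.
have [v0|v0] := eqVneq (enorm v) 0; first by rewrite v0 mulr0 enorm_ge0.
have vp : 0 < enorm v by rewrite lt_neqAle eq_sym v0 enorm_ge0.
rewrite -(ler_pM2l vp) mulrCA -expr2.
exact: le_trans (Amu v) (inner_le _ _).
Qed.

Lemma coercive_unit : A \in unitmx.
Proof.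
rewrite -unitmx_tr -row_free_unit; apply: inj_row_free => v vA.
have : enorm (A *m v^T) = 0.
  by rewrite -[A]trmxK -trmx_mul vA trmx0 enorm0.
move=> h; have := coercive_lower v^T; rewrite h pmulr_rle0// => h'.
apply: trmx_inj; rewrite trmx0; apply: enorm_eq0.
by apply/eqP; rewrite eq_le h' enorm_ge0.
Qed.

Lemma coercive_inv v : enorm (invmx A *m v) <= mu^-1 * enorm v.
Proof.
rewrite mulrC ler_pdivlMr// mulrC (le_trans (coercive_lower _))//.
by rewrite mulmxA mulmxV ?coercive_unit// mul1mx.
Qed.
End Coercive.

Section Matrix_identities.
Variables (R : realType) (k l : nat).

Lemma invmx_mul_diff (A B : 'M[R]_k) (v : 'cV[R]_k) :
  A \in unitmx -> B \in unitmx ->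
  invmx A *m v - invmx B *m v = - (invmx A *m ((A - B) *m (invmx B *m v))).
Proof.
move=> uA uB; rewrite mulmxBl mulmxBr opprB; congr (_ - _).
  by rewrite (mulmxA B) mulmxV// mul1mx.
by rewrite (mulmxA (invmx A)) mulVmx// mul1mx.
Qed.

Lemma mulmx_diff (A A' : 'M[R]_(l, k)) (B B' : 'M[R]_k) (a : 'cV[R]_l)
    (v : 'cV[R]_k) :
  (a - A *m B *m v) - (a - A' *m B' *m v) =
  - ((A - A') *m (B *m v) + A' *m (B *m v - B' *m v)).
Proof.
by rewrite mulmxBl mulmxBr subrKA -!mulmxA !opprB addrC addrA subrK.
Qed.

Lemma mulmx_diff3 (A A' : 'M[R]_k) (Y Y' : 'M[R]_(k, l)) (u u' : 'cV[R]_l) :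
  - (A *m Y *m u) - - (A' *m Y' *m u') =
  - (A *m (Y *m (u - u')) +
     (A *m ((Y - Y') *m u') + (A *m (Y' *m u') - A' *m (Y' *m u')))).
Proof.
rewrite -!mulmxA -opprD; congr (- _).
rewrite mulmxBr mulmxBl !mulmxBr (addrA (A *m (Y *m u') - _)) subrK.
by rewrite addrA subrK.
Qed.

(** Linearized change of [grady] in one step: the contributions of [P] cancel and only the damping
    [H *m u] remains. *)
Lemma newton_cancel (H : 'M[R]_k) (Y : 'M[R]_(k, l)) (P : 'cV[R]_l)
    (u : 'cV[R]_k) (et be : R) :
  H \in unitmx ->
  Y *m - (et *: P) + H *m - (et *: (be *: u - invmx H *m Y *m P)) =
  - ((et * be) *: (H *m u)).
Proof.
move=> uH; rewrite !mulmxN -!scalemxAr mulmxBr -mulmxA (mulmxA H) mulmxV//.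
by rewrite mul1mx -scalemxAr scalerBr scalerA opprB addrA addNr add0r.
Qed.

End Matrix_identities.

(** * The direction field of the bilevel iteration *)

Section Bilevel.
Variables (R : realType) (n p : nat) (g : 'cV[R]_n -> 'cV[R]_p -> R).
Variables (mu Lg Qg : R).
Hypotheses (mu0 : 0 < mu) (Lg0 : 0 < Lg) (Qg0 : 0 < Qg).
Hypothesis dg : forall z, differentiable (joint g) z.
Hypothesis dgg : forall z, differentiable (gradg g) z.
Hypothesis Hmu : forall x0 y0 v, mu * enorm v ^+ 2 <= inner v (Hyy g x0 y0 *m v).
Hypothesis gradL : forall x1 y1 x2 y2,
  enorm (gradg g (col_mx x1 y1) - gradg g (col_mx x2 y2))
    <= Lg * enorm (col_mx x1 y1 - col_mx x2 y2).
Hypothesis HyyQ : forall x1 y1 x2 y2,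
  opnorm (Hyy g x1 y1 - Hyy g x2 y2) <= Qg * enorm (col_mx x1 y1 - col_mx x2 y2).
Hypothesis HxyQ : forall x1 y1 x2 y2,
  opnorm (Hxy g x1 y1 - Hxy g x2 y2) <= Qg * enorm (col_mx x1 y1 - col_mx x2 y2).

(** By symmetry of [Hyy] this is the positive semidefinite map P^T P applied to [d], where P is the
    block row [I, - Hxy Hyy^-1] that computes [px_dir]. *)
Definition flow_dir (z d : 'cV[R]_(n + p)) : 'cV[R]_(n + p) :=
  let x := usubmx z in let y := dsubmx z in
  col_mx (px_dir g x y d) (- (invmx (Hyy g x y) *m Hyx g x y *m px_dir g x y d)).

Let i := mu^-1.
(** [kap] bounds the norm of P, and [K1] is a Lipschitz constant for it: variation of [Hxy], then of
    the inverse of [Hyy]. *)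
Let kap := 1 + Lg * i.
Let K1 := Qg * i + Lg * (i * (Qg * i)).

Let i0 : 0 < i. Proof. by rewrite invr_gt0. Qed.
Let kap0 : 0 < kap. Proof. by rewrite ltr_pwDl// mulr_ge0// ltW. Qed.
Let invH x y v : enorm (invmx (Hyy g x y) *m v) <= i * enorm v.
Proof. exact: coercive_inv (Hmu x y) v. Qed.

Let invH_lip x1 y1 x2 y2 v :
  enorm (invmx (Hyy g x1 y1) *m v - invmx (Hyy g x2 y2) *m v) <=
  i * (Qg * i) * enorm (col_mx x1 y1 - col_mx x2 y2) * enorm v.
Proof.
set D := enorm (_ - _ : 'cV_(n + p)).
have u1 := coercive_unit mu0 (Hmu x1 y1); have u2 := coercive_unit mu0 (Hmu x2 y2).
rewrite (invmx_mul_diff v u1 u2).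
rewrite enormN (le_trans (invH _ _ _))// -!mulrA ler_pM2l//.
rewrite (le_trans (Hyy_lip HyyQ _ _ _ _ _))// -/D -mulrA ler_pM2l// mulrCA.
by rewrite ler_wpM2l ?enorm_ge0// invH.
Qed.

Lemma px_dir_bound x y d : enorm (px_dir g x y d) <= kap * enorm d.
Proof.
rewrite /px_dir (le_trans (enormB _ _))// mulrDl mul1r lerD ?enorm_usubmx//.
rewrite -mulmxA (le_trans (Hxy_bound dgg Lg0 Qg0 gradL HyyQ HxyQ _ _ _))// -mulrA.
rewrite ler_pM2l// (le_trans (invH _ _ _))// ler_pM2l// enorm_dsubmx//.
Qed.

Lemma px_dir_lip x1 y1 x2 y2 d : enorm (px_dir g x1 y1 d - px_dir g x2 y2 d) <=
  K1 * enorm (col_mx x1 y1 - col_mx x2 y2) * enorm d.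
Proof.
set D := enorm (_ - _ : 'cV_(n + p)).
set v := dsubmx d.
have D0 : 0 <= D by exact: enorm_ge0.
have -> : px_dir g x1 y1 d - px_dir g x2 y2 d =
  - ((Hxy g x1 y1 - Hxy g x2 y2) *m (invmx (Hyy g x1 y1) *m v) +
     Hxy g x2 y2 *m (invmx (Hyy g x1 y1) *m v - invmx (Hyy g x2 y2) *m v)).
  exact: mulmx_diff.
rewrite enormN (le_trans (enormD _ _))//.
have vd : enorm v <= enorm d by exact: enorm_dsubmx.
have b1 : enorm ((Hxy g x1 y1 - Hxy g x2 y2) *m (invmx (Hyy g x1 y1) *m v)) <=
    Qg * i * D * enorm d.
  rewrite (le_trans (Hxy_lip HxyQ _ _ _ _ _))// -/D -!mulrA ler_pM2l// mulrCA.
  rewrite ler_wpM2l// (le_trans (invH _ _ _))// ler_pM2l//.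
have b2 : enorm (Hxy g x2 y2 *m (invmx (Hyy g x1 y1) *m v -
    invmx (Hyy g x2 y2) *m v)) <= Lg * (i * (Qg * i)) * D * enorm d.
  rewrite (le_trans (Hxy_bound dgg Lg0 Qg0 gradL HyyQ HxyQ _ _ _))//.
  rewrite -2!(mulrA Lg) ler_pM2l// (le_trans (invH_lip _ _ _ _ _))// -/D.
  by rewrite ler_wpM2l// !mulr_ge0// ltW.
by rewrite /K1; lra.
Qed.

Lemma flow_dirD z a d b d' :
  flow_dir z (a *: d + b *: d') = a *: flow_dir z d + b *: flow_dir z d'.
Proof.
have pD x y : px_dir g x y (a *: d + b *: d') =
    a *: px_dir g x y d + b *: px_dir g x y d'.
  have lin (A : 'M[R]_(n, p)) : usubmx (a *: d + b *: d') -
      A *m dsubmx (a *: d + b *: d') =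
      a *: (usubmx d - A *m dsubmx d) + b *: (usubmx d' - A *m dsubmx d').
    have -> : usubmx (a *: d + b *: d') = a *: usubmx d + b *: usubmx d'.
      by apply/colP => k; rewrite !mxE.
    have -> : dsubmx (a *: d + b *: d') = a *: dsubmx d + b *: dsubmx d'.
      by apply/colP => k; rewrite !mxE.
    by rewrite mulmxDr -!scalemxAr opprD !scalerBr addrACA.
  exact: lin.
rewrite /flow_dir pD !scale_col_mx add_col_mx; congr col_mx.
by rewrite mulmxDr -!scalemxAr opprD !scalerN.
Qed.

Lemma flow_dir_bound z d : enorm (flow_dir z d) <= kap * kap * enorm d.
Proof.
rewrite /flow_dir; set x := usubmx z; set y := dsubmx z.
rewrite (le_trans (enorm_col_mx_le _ _))// enormN -mulrA.
have := px_dir_bound x y d; set P := px_dir g x y d => hP.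
apply: (@le_trans _ _ (kap * enorm P)); last by rewrite ler_pM2l.
rewrite mulrDl mul1r lerD2l -mulmxA (le_trans (invH _ _ _))// (mulrC Lg) -mulrA.
rewrite ler_pM2l//; exact: (Hyx_bound dgg Lg0 Qg0 gradL HyyQ HxyQ _ _ _).
Qed.

(** Product rule for P^T P: each of the two factors contributes [kap * K1]. *)
Lemma flow_dir_lip z z' d : enorm (flow_dir z d - flow_dir z' d) <=
  (2 * kap * K1) * enorm (z - z') * enorm d.
Proof.
rewrite -(vsubmxK z) -(vsubmxK z') /flow_dir !col_mxKu !col_mxKd.
set x1 := usubmx z; set y1 := dsubmx z; set x2 := usubmx z'; set y2 := dsubmx z'.
set D := enorm (col_mx x1 y1 - _).
have D0 : 0 <= D by exact: enorm_ge0.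
have hP := px_dir_lip x1 y1 x2 y2 d; have bP := px_dir_bound x2 y2 d.
rewrite -/D in hP; set P1 := px_dir g x1 y1 d in hP *; set P2 := px_dir g x2 y2 d in hP bP *.
rewrite opp_col_mx add_col_mx (le_trans (enorm_col_mx_le _ _))//.
have yxB := Hyx_bound dgg Lg0 Qg0 gradL HyyQ HxyQ.
rewrite mulmx_diff3.
rewrite enormN (le_trans (lerD (lexx _) (enormD _ _)))//.
rewrite (le_trans (lerD (lexx _) (lerD (lexx _) (enormD _ _))))//.
have b1 : enorm (invmx (Hyy g x1 y1) *m (Hyx g x1 y1 *m (P1 - P2))) <=
    i * (Lg * (K1 * D * enorm d)).
  rewrite (le_trans (invH _ _ _))// ler_pM2l// (le_trans (yxB _ _ _))//.
  by rewrite ler_pM2l.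
have b2 : enorm (invmx (Hyy g x1 y1) *m ((Hyx g x1 y1 - Hyx g x2 y2) *m P2)) <=
    i * (Qg * D * (kap * enorm d)).
  rewrite (le_trans (invH _ _ _))// ler_pM2l//.
  rewrite (le_trans (Hyx_lip Qg0 HxyQ _ _ _ _ _))// -/D ler_wpM2l// mulr_ge0// ltW//.
have b3 : enorm (invmx (Hyy g x1 y1) *m (Hyx g x2 y2 *m P2) -
       invmx (Hyy g x2 y2) *m (Hyx g x2 y2 *m P2)) <=
    i * (Qg * i) * D * (Lg * (kap * enorm d)).
  rewrite (le_trans (invH_lip _ _ _ _ _))// -/D ler_wpM2l//.
    by rewrite !mulr_ge0// ltW.
  by rewrite (le_trans (yxB _ _ _))// ler_pM2l.
have -> : 2 * kap * K1 * D * enorm d = K1 * D * enorm d +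
    (i * (Lg * (K1 * D * enorm d)) + (i * (Qg * D * (kap * enorm d)) +
      i * (Qg * i) * D * (Lg * (kap * enorm d)))).
  by rewrite /K1 /kap; ring.
by rewrite lerD// lerD// lerD.
Qed.

Lemma flow_dir_inner x y d :
  inner (flow_dir (col_mx x y) d) d = enorm (px_dir g x y d) ^+ 2.
Proof.
rewrite /flow_dir col_mxKu col_mxKd enorm_sqr; set P := px_dir g x y d.
rewrite -{1}(vsubmxK d) inner_col_mx innerNl inner_trmx trmx_mul trmx_inv.
rewrite (Hyy_sym dg dgg Qg0 HyyQ) /Hyx trmxK -innerBr.
by rewrite /P /px_dir.
Qed.

(** In the squared norm of the linear part, [et * be * Lg ^+ 2 <= mu] lets the second-order term
    consume at most half of the first-order decrease; [et * be * mu <= 2] makes the contraction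
    factor nonnegative, so that squares can be compared. *)
Lemma grady_step x y d (be et V : R) : 0 <= be -> 0 <= et ->
  et * be * Lg ^+ 2 <= mu -> et * be * mu <= 2 ->
  enorm (flow_dir (col_mx x y) d + col_mx 0 (be *: grady g x y)) <= V ->
  enorm (grady g (x - et *: px_dir g x y d) (y - et *: (be *: grady g x y -
     invmx (Hyy g x y) *m Hyx g x y *m px_dir g x y d)))
  <= (1 - be * mu / 2 * et) * enorm (grady g x y) +
     p%:R * (2 * Qg) * V ^+ 2 * et ^+ 2.
Proof.
move=> be0 et0 et1 et2; rewrite /flow_dir col_mxKu col_mxKd.
set P := px_dir g x y d; set H := Hyy g x y; set u := grady g x y.
set W := be *: u - _; rewrite add_col_mx addr0 (addrC (- _)) -/W => hV.
have := grady_taylor dgg Qg0 HyyQ HxyQ x y (- (et *: P)) (- (et *: W)).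
set u' := grady g _ _; rewrite -/u.
have uH : H \in unitmx by exact: coercive_unit mu0 (Hmu x y).
rewrite {1}/W newton_cancel//.
have -> : col_mx (- (et *: P)) (- (et *: W)) = (- et) *: col_mx P W.
  by rewrite scale_col_mx !scaleNr.
rewrite enormZ normrN (ger0_norm et0) exprMn opprK => rem.
have main : enorm (u - (et * be) *: (H *m u)) <= (1 - be * mu / 2 * et) * enorm u.
  rewrite -(@ler_pXn2r _ 2)// ?nnegrE ?enorm_ge0//; last first.
    by rewrite mulr_ge0 ?enorm_ge0//; move: et2; lra.
  rewrite enorm_sqr innerBl !innerBr !innerZl !innerZr (innerC (H *m u)) -!enorm_sqr.
  have h1 := Hmu x y u; rewrite -/H in h1.
  have h2 : enorm (H *m u) ^+ 2 <= Lg ^+ 2 * enorm u ^+ 2.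
    have LU : 0 <= Lg * enorm u by rewrite mulr_ge0 ?enorm_ge0// ltW.
    rewrite -exprMn ler_pXn2r ?nnegrE ?enorm_ge0//.
    exact: (Hyy_bound dgg Lg0 Qg0 gradL HyyQ HxyQ _ _ _).
  set a := et * be in et1 et2 *; set U := enorm u ^+ 2 in h1 h2 *.
  have a0 : 0 <= a by rewrite mulr_ge0.
  have U0 : 0 <= U by exact: sqr_ge0.
  set hu := inner u _ in h1 *; set hh := enorm _ ^+ 2 in h2 *.
  rewrite (_ : be * mu / 2 * et = a * mu / 2); last by rewrite /a; ring.
  rewrite exprMn -/U.
  have k1 : a * (mu * U) <= a * hu by rewrite ler_wpM2l.
  have k2 : a * (a * hh) <= a * (mu * U).
    rewrite ler_wpM2l// (le_trans (ler_wpM2l a0 h2))// mulrA ler_wpM2r//.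
  have k3 : 0 <= (a * mu) ^+ 2 * U by rewrite mulr_ge0// sqr_ge0.
  by rewrite (_ : (1 - a * mu / 2) ^+ 2 * U = U - a * (mu * U) +
     (a * mu) ^+ 2 * U / 4); [move: k1 k2 k3; lra|field].
have -> : u' = (u - (et * be) *: (H *m u)) + (u' - u + (et * be) *: (H *m u)).
  by rewrite addrACA addNr addr0 [RHS]addrC subrK.
rewrite (le_trans (enormD _ _))// lerD// (le_trans rem)//.
have V0 : 0 <= V by rewrite (le_trans _ hV)// enorm_ge0.
have pQ : 0 <= p%:R * (2 * Qg) by rewrite !mulr_ge0// ltW.
rewrite -[leRHS]mulrA [V ^+ 2 * _]mulrC ler_wpM2l// ler_wpM2l ?sqr_ge0//.
by rewrite ler_pXn2r ?nnegrE ?enorm_ge0.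
Qed.

End Bilevel.

(** * The algorithm as a perturbed iteration along [flow_dir] *)

Theorem theorem4p4 (R : realType) (n p : nat)
  (f g : 'cV[R]_n -> 'cV[R]_p -> R)
  (Df : 'cV[R]_(n + p) -> set 'cV[R]_(n + p))
  (Mf mu Lg Qg : R) (beta : R)
  (x : nat -> 'cV[R]_n) (y w : nat -> 'cV[R]_p) (d : nat -> 'cV[R]_(n + p))
  (eta eps : nat -> R) :
  (* (A1) *)
  0 < Mf -> 0 < mu -> 0 < Lg -> 0 < Qg ->
  (forall x1 y1 x2 y2,
      `|f x1 y1 - f x2 y2| <= Mf * enorm (col_mx x1 y1 - col_mx x2 y2)) ->
  (forall z, differentiable (joint g) z) ->
  (forall z, differentiable (gradg g) z) ->
  (forall x0 y0 v, mu * enorm v ^+ 2 <= inner v (Hyy g x0 y0 *m v)) ->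
  (forall x1 y1 x2 y2,
      enorm (gradg g (col_mx x1 y1) - gradg g (col_mx x2 y2))
        <= Lg * enorm (col_mx x1 y1 - col_mx x2 y2)) ->
  (forall x1 y1 x2 y2,
      opnorm (Hyy g x1 y1 - Hyy g x2 y2)
        <= Qg * enorm (col_mx x1 y1 - col_mx x2 y2)) ->
  (forall x1 y1 x2 y2,
      opnorm (Hxy g x1 y1 - Hxy g x2 y2)
        <= Qg * enorm (col_mx x1 y1 - col_mx x2 y2)) ->
  (forall z, differentiable (Hyy_joint g) z) ->
  (forall v, continuous (fun z => 'd (Hyy_joint g) z v)) ->
  (* (A2) *)
  conservative_field Df -> is_potential (joint f) Df ->
  (forall z, convex_subset (Df z)) ->
  (forall z v, Df z v -> enorm v <= Mf) ->
  (* choice of beta *)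
  Num.max (8 * Mf * Qg / mu ^+ 3)
          (4 * Mf * Qg * Lg / (mu ^+ 3 * Num.sqrt mu)) <= beta ->
  (* Algorithm 3 *)
  (forall k, enorm (Hyy g (x k) (y k) *m w k - grady g (x k) (y k)) <= eps k) ->
  (forall k, Df (col_mx (x k) (y k - w k)) (d k)) ->
  (forall k, x k.+1 = x k - eta k *: px_dir g (x k) (y k) (d k)) ->
  (forall k, y k.+1 = y k - eta k *:
       (beta *: grady g (x k) (y k)
        - invmx (Hyy g (x k) (y k)) *m Hyx g (x k) (y k)
            *m px_dir g (x k) (y k) (d k))) ->
  (* (a) *)
  (exists B : R, forall k, enorm (x k) + enorm (y k) <= B) ->
  (* (b) *)
  (forall k, 0 <= eta k) ->
  series eta @ \oo --> +oo ->
  cvgn (series (fun k => eta k ^+ 2)) ->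
  (* (c) *)
  interior [set r : R | exists x0 y0, stationary Df g x0 y0 /\ r = f x0 y0]
    = set0 ->
  eps @ \oo --> 0 ->
  (forall xb yb, seq_limit_point x y xb yb -> stationary Df g xb yb) /\
  cvgn (fun k => hfun f g beta (x k) (y k)).
Proof.
move=> Mf0 mu0 Lg0 Qg0 fM dg dgg Hmu gradL HyyQ HxyQ _ _ [Dclosed [Dne [_ _]]] Fpot
  Dconv Dbd hbeta wP dD xS yS [B zB0] eta0 etaoo eta2 S0 eps0.
have beta0 : 0 < beta.
  apply: lt_le_trans hbeta; rewrite lt_max; apply/orP; left.
  by rewrite divr_gt0 ?exprn_gt0// !mulr_gt0.
pose u (z : 'cV[R]_(n + p)) := grady g (usubmx z) (dsubmx z).
have uL a b : enorm (u a - u b) <= Lg * enorm (a - b).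
  by have := grady_lip gradL (usubmx a) (dsubmx a) (usubmx b) (dsubmx b);
     rewrite !vsubmxK.
pose z k := col_mx (x k) (y k).
pose q k := col_mx (x k) (y k - w k).
pose uk k := grady g (x k) (y k).
have ukE k : u (z k) = uk k by rewrite /u /z col_mxKu col_mxKd.
pose r k : 'cV[R]_(n + p) := col_mx 0 (beta *: uk k).
have rE k : enorm (r k) <= beta * enorm (uk k).
  rewrite (le_trans (enorm_col_mx_le _ _))// enorm0 add0r enormZ gtr0_norm//.
have zB k : enorm (z k) <= B by exact: le_trans (enorm_col_mx_le _ _) (zB0 k).
pose Br := beta * (enorm (u 0) + Lg * B).
have rB k : enorm (r k) <= Br.
  rewrite (le_trans (rE k))// ler_pM2l// -ukE.
  have := uL (z k) 0; rewrite subr0 => h.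
  have := enormD (u (z k) - u 0) (u 0); rewrite subrK.
  have : Lg * enorm (z k) <= Lg * B by rewrite ler_pM2l.
  by move: h; lra.
have zS k : z k.+1 = z k - eta k *: (flow_dir g (z k) (d k) + r k).
  rewrite /z /flow_dir col_mxKu col_mxKd xS yS /r add_col_mx addr0 scale_col_mx.
  by rewrite opp_col_mx add_col_mx [- _ + _]addrC.
have eta_small e : 0 < e -> exists K, forall k, (K <= k)%N -> eta k < e.
  move=> e0; have /cvgrPdist_lt := cvg_series_cvg_0 eta2.
  move=> /(_ (e ^+ 2)); rewrite exprn_gt0// => /(_ isT)[K _ KP].
  exists K => k /KP /=; rewrite sub0r normrN ger0_norm ?sqr_ge0//.
  by rewrite ltr_pXn2r// ?nnegrE// ltW.
pose kap := 1 + Lg * mu^-1.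
pose C1 := kap * kap.
have C10 : 0 <= C1 by rewrite mulr_ge0// addr_ge0// mulr_ge0// ?invr_ge0 ltW.
pose V := C1 * Mf + Br.
have Lzbd a b : enorm (flow_dir g a b) <= C1 * enorm b.
  exact: (flow_dir_bound mu0 Lg0 Qg0 dgg Hmu gradL HyyQ HxyQ).
have VP k : enorm (flow_dir g (z k) (d k) + r k) <= V.
  rewrite (le_trans (enormD _ _))// lerD// (le_trans (Lzbd _ _))//.
  by rewrite ler_wpM2l// (Dbd _ _ (dD k)).
have u_small e : 0 < e -> exists K, forall k, (K <= k)%N -> enorm (uk k) < e.
  have [K1 K1P] : exists K, forall k, (K <= k)%N -> eta k < mu / (beta * Lg ^+ 2).
    by apply: eta_small; rewrite divr_gt0// mulr_gt0// exprn_gt0.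
  have [K2 K2P] : exists K, forall k, (K <= k)%N -> eta k < 2 / (beta * mu).
    by apply: eta_small; rewrite divr_gt0// mulr_gt0.
  apply: (@contraction_cvg0 _ _ eta (beta * mu / 2)
    (p%:R * (2 * Qg) * V ^+ 2) (maxn K1 K2)) => //.
  - by rewrite divr_gt0// mulr_gt0.
  - by rewrite mulr_ge0 ?sqr_ge0// !mulr_ge0// ltW.
  - by move=> k; exact: enorm_ge0.
  move=> k; rewrite geq_max => /andP[/K1P h1 /K2P h2].
  rewrite /uk xS yS; apply: (grady_step mu0 Lg0 Qg0 dgg Hmu gradL HyyQ HxyQ) => //.
  - exact: ltW.
  - by move: h1; rewrite ltr_pdivlMr ?mulr_gt0 ?exprn_gt0// mulrA => /ltW.
  - by move: h2; rewrite ltr_pdivlMr ?mulr_gt0// mulrA => /ltW.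
  - exact: VP.
(* Coercivity bounds [w k] by its image under [Hyy], which is within [eps k] of the vanishing
   [uk k]. *)
have w_small e : 0 < e -> exists K, forall k, (K <= k)%N -> enorm (w k) < e.
  move=> e0; have e1 : 0 < mu * e / 2 by rewrite divr_gt0// mulr_gt0.
  have [K1 K1P] := u_small _ e1.
  have /cvgrPdist_lt/(_ _ e1)[K2 _ K2P] := eps0.
  exists (maxn K1 K2) => k; rewrite geq_max => /andP[/K1P h1 /K2P /=].
  rewrite sub0r normrN => h2; have h3 := le_lt_trans (ler_norm _) h2.
  rewrite -(ltr_pM2l mu0) (le_lt_trans (coercive_lower (Hmu (x k) (y k)) _))//.
  rewrite -[_ *m w k](subrK (uk k)) (le_lt_trans (enormD _ _))//.
  by have := wP k; rewrite -/(uk k); move: h1 h3; lra.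
have qz e : 0 < e -> exists K, forall k, (K <= k)%N -> enorm (q k - z k) < e.
  move=> /w_small[K KP]; exists K => k /KP; apply: le_lt_trans.
  rewrite /q /z opp_col_mx add_col_mx subrr (le_trans (enorm_col_mx_le _ _))//.
  by rewrite enorm0 add0r addrAC subrr add0r enormN.
have r_small e : 0 < e -> exists K, forall k, (K <= k)%N -> enorm (r k) < e.
  move=> e0; have [K KP] := u_small (e / beta) ltac:(by rewrite divr_gt0).
  exists K => k /KP; rewrite ltr_pdivlMr// mulrC; exact: le_lt_trans (rE k).
have FM a b : `|joint f a - joint f b| <= Mf * enorm (a - b).
  by have := fM (usubmx a) (dsubmx a) (usubmx b) (dsubmx b); rewrite !vsubmxK.
have Lin a b : inner (flow_dir g a b) b =
    enorm (px_dir g (usubmx a) (dsubmx a) b) ^+ 2.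
  by rewrite -{1}(vsubmxK a) (flow_dir_inner Qg0 dg dgg HyyQ).
have Lz0 a b : 0 <= inner (flow_dir g a b) b by rewrite Lin sqr_ge0.
pose C2 := 2 * kap * (Qg * mu^-1 + Lg * (mu^-1 * (Qg * mu^-1))).
have C20 : 0 <= C2.
  have i0 : 0 <= mu^-1 by rewrite invr_ge0 ltW.
  have Q0 := ltW Qg0; have L0 := ltW Lg0.
  by rewrite !mulr_ge0// addr_ge0 ?mulr_ge0.
have Lzlip a b c : enorm (flow_dir g a c - flow_dir g b c) <=
    C2 * enorm (a - b) * enorm c.
  exact: (flow_dir_lip mu0 Lg0 Qg0 dgg Hmu gradL HyyQ HxyQ).
have dDq k : Df (q k) (d k) by exact: dD.
have cl0 zeta : cluster_value z zeta -> u zeta = 0.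
  move=> cl; apply: enorm_eq0; apply/eqP; rewrite eq_le enorm_ge0 andbT.
  apply/ler_addgt0Pr => e e0; rewrite add0r.
  have [K KP] := u_small (e / 2) ltac:(by rewrite divr_gt0).
  have [|k Kk kz] := cl (e / (2 * Lg)) K; first by rewrite divr_gt0// mulr_gt0.
  have := enorm_triangle (u (z k)) (u zeta) 0; rewrite !subr0 => /le_trans; apply.
  have := uL zeta (z k); have := KP k Kk; rewrite -ukE.
  by move: kz; rewrite enormC ltr_pdivlMr ?mulr_gt0//; lra.
have stat zeta : cluster_value z zeta -> critical Df (flow_dir g) zeta ->
    stationary Df g (usubmx zeta) (dsubmx zeta).
  move=> cl [d' Dd']; rewrite Lin => /eqP; rewrite sqrf_eq0 => /eqP/enorm_eq0 h.
  by exists d'; rewrite vsubmxK; split => //; split => //; exact: cl0.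
have := @values_converge R (n + p) (joint f) Df (flow_dir g) Mf C1 C2 Mf0 C10 C20
  Dclosed Dne Dconv Dbd (flow_dirD g) Lzbd Lzlip z d q r eta B Br zS dDq qz r_small
  rB zB eta0 eta_small etaoo Fpot FM Lz0 _ S0.
case=> [zeta cl cr|l lP].
  by exists (usubmx zeta), (dsubmx zeta); split => //; exact: stat.
split.
  move=> xb yb [phi [phi_lt [cx cy]]].
  have phi_ge j : (j <= phi j)%N.
    by elim: j => // j IH; exact: leq_ltn_trans IH (phi_lt j).
  have conv e : 0 < e -> exists J, forall j, (J <= j)%N ->
      enorm (z (phi j) - col_mx xb yb) < e.
    move=> e0; have e2 : 0 < e / 2 by rewrite divr_gt0.
    have /cvg_enormP/(_ _ e2)[J1 _ J1P] := cx.
    have /cvg_enormP/(_ _ e2)[J2 _ J2P] := cy.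
    exists (maxn J1 J2) => j; rewrite geq_max => /andP[/J1P /= h1 /J2P /= h2].
    rewrite /z opp_col_mx add_col_mx (le_lt_trans (enorm_col_mx_le _ _))//.
    by move: h1 h2; lra.
  have cl : cluster_value z (col_mx xb yb).
    move=> e J /conv[J' J'P]; exists (phi (maxn J J')).
      exact: leq_trans (leq_maxl _ _) (phi_ge _).
    by apply: J'P; exact: leq_maxr.
  have := stat _ cl; rewrite col_mxKu col_mxKd; apply.
  exact: (@limit_critical R (n + p) (joint f) Df (flow_dir g) Mf C1 C2 Mf0 C10 C20
    Dclosed Dne Dconv Dbd (flow_dirD g) Lzbd Lzlip z d q r eta B Br zS dDq qz r_small
    rB zB eta0 eta_small etaoo Fpot FM Lz0 l phi (col_mx xb yb) lP phi_ge conv).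
apply/cvg_ex; exists l; apply/cvgrPdist_lt => e e0.
(* Once [U <= 1], [hfun] and [f] differ by at most [G * U]: the Newton correction has norm at most
   [U / mu], and [U ^+ 2 <= U]. *)
pose G := Mf / mu + beta / 2.
have G0 : 0 < G by rewrite addr_gt0 ?divr_gt0.
have [K1 K1P] := lP (e / 2) ltac:(by rewrite divr_gt0).
have [K2 K2P] := u_small (e / 2 / G) ltac:(by rewrite !divr_gt0).
have [K3 K3P] := u_small 1 ltr01.
exists (maxn K1 (maxn K2 K3)) => // k /=.
rewrite !geq_max => /andP[/K1P h1 /andP[/K2P h2 /K3P h3]].
rewrite distrC /hfun -/(uk k).
set U := enorm (uk k) in h2 h3 *; have U0 : 0 <= U by exact: enorm_ge0.
have U2 : U ^+ 2 <= U by rewrite expr2 ler_piMl// ltW.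
have hA : `|f (x k) (Amap g (x k) (y k)) - joint f (z k)| <= Mf * (mu^-1 * U).
  rewrite /joint /z col_mxKu col_mxKd (le_trans (fM _ _ _ _))// ler_pM2l//.
  rewrite opp_col_mx add_col_mx subrr (le_trans (enorm_col_mx_le _ _))//.
  rewrite enorm0 add0r /Amap addrAC subrr add0r enormN.
  exact: (coercive_inv mu0 (Hmu (x k) (y k))).
move: h2; rewrite ltr_pdivlMr// /G => h2.
have bU : beta / 2 * U ^+ 2 <= beta / 2 * U by rewrite ler_pM2l// divr_gt0.
have bU0 : 0 <= beta / 2 * U ^+ 2 by rewrite mulr_ge0 ?sqr_ge0// divr_ge0// ltW.
move: hA h1; rewrite ler_norml !ltr_norml => /andP[a1 a2] /andP[b1 b2].
by apply/andP; split; move: a1 a2 b1 b2 h2 bU bU0; lra.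
Qed.
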